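(* Let $s^*\le 1$ be real and let $F$ be a non-degenerate distribution function on $\mathbb{R}$, with $J(F)=\{x\in\mathbb{R}:0<F(x)<1\}$. The following statements are equivalent: (i) $F$ is bi-$s^*$-concave. (ii) $F$ is continuous on $\mathbb{R}$ and differentiable on $J(F)$ with derivative $f=F'$, and moreover for all $x,y\in J(F)$: if $s^*\ne 0$, $$F(y)\le F(x)\Big(1+s^*\tfrac{f(x)}{F(x)}(y-x)\Big)_+^{1/s^*},\qquad F(y)\ge 1-(1-F(x))\Big(1-s^*\tfrac{f(x)}{1-F(x)}(y-x)\Big)_+^{1/s^*},$$ while if $s^*=0$, $$F(y)\le F(x)\exp\Big(\tfrac{f(x)}{F(x)}(y-x)\Big),\qquad F(y)\ge 1-(1-F(x))\exp\Big(-\tfrac{f(x)}{1-F(x)}(y-x)\Big).$$ (iii) $F$ is continuous on $\mathbb{R}$ and differentiable on $J(F)$ with derivative $f=F'$ such that the $s^*$-hazard function $f/(1-F)^{1-s^*}$ is non-decreasing on $J(F)$, and the reverse $s^*$-hazard function $f/F^{1-s^*}$ is non-increasing on $J(F)$. (iv) $F$ is continuous on $\mathbb{R}$ and differentiable on $J(F)$ with bounded and strictly positive derivative $f=F'$. Furthermore, $f$ is differentiable almost everywhere on $J(F)$ with derivative $f'=F''$ satisfying $$-(1-s^* )\frac{f^2}{1-F}\le f'\le(1-s^* )\frac{f^2}{F}\quad\text{almost everywhere on } J(F).$$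
   Context: Definition. For $-\infty<s^*<0$, a distribution function $F$ on $\mathbb{R}$ is bi-$s^*$-concave if both $x\mapsto F^{s^*}(x)$ and $x\mapsto(1-F(x))^{s^*}$ are convex functions from $\mathbb{R}$ to $[0,\infty]$ (with $0^{s^*}=\infty$). For $s^*=0$, $F$ is bi-$s^*$-concave if both $x\mapsto\log F(x)$ and $x\mapsto\log(1-F(x))$ are concave functions from $\mathbb{R}$ to $[-\infty,0]$. For $0<s^*\le1$, $F$ is bi-$s^*$-concave if $x\mapsto F^{s^*}(x)$ is concave from $(\inf J(F),\infty)$ to $[0,1]$ and $x\mapsto(1-F(x))^{s^*}$ is concave from $(-\infty,\sup J(F))$ to $[0,1]$. Notation: $x_+=\max\{x,0\}$; for $s^*<0$, $0^{1/s^*}=+\infty$. Non-degenerate means that $F$ is not the distribution function of a point mass. ''Almost everywhere'' refers to Lebesgue measure.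
   Formalization: In (iv), f' is required in addition to be the L1-derivative of f: f(y)-f(x) is the integral of f' over [x,y] for x≤y in J(F). Without this, (iv) does not imply (i): the density (1+c)/(3/2) on (0,1), c the Cantor function, is a counterexample. *)

(* Defs.v *)
From HB Require Import structures.
From mathcomp Require Import all_boot all_order all_algebra.
From mathcomp Require Import all_classical all_reals all_analysis.

Set Implicit Arguments.
Unset Strict Implicit.
Unset Printing Implicit Defensive.

Import Order.TTheory GRing.Theory Num.Theory.
Import numFieldNormedType.Exports.

Local Open Scope classical_set_scope.
Local Open Scope ring_scope.

Section bi_s_concave.
Context {R : realType}.
Implicit Types (F f : R -> R) (g : R -> \bar R) (s : R).

(* F is the distribution function of a point mass *)
Definition degenerate F : Prop :=
  exists a : R, forall x, ((F x)%:E = \d_a `]-oo, x])%E.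

Definition J F : set R := [set x | 0 < F x < 1].

(* x `^ s for x >= 0, except that 0 to a negative power is +oo, whereas the
   library's powR has 0 `^ s = 0 for every s != 0. *)
Definition epow (x s : R) : \bar R :=
  if (x == 0) && (s < 0) then +oo%E else (x `^ s)%:E.

Definition pospart (x : R) : R := Num.max x 0.

(* Only used below for g valued in [0, +oo] and [-oo, 0] respectively, so that
   the sums make sense; 0 * +oo = 0 makes the cases t = 0, 1 trivial. *)
Definition econvex g : Prop := forall x y t : R, 0 <= t <= 1 ->
  (g (t * x + (1 - t) * y)%R <= t%:E * g x + (1 - t)%:E * g y)%E.

Definition econcave g : Prop := forall x y t : R, 0 <= t <= 1 ->
  (t%:E * g x + (1 - t)%:E * g y <= g (t * x + (1 - t) * y)%R)%E.

Definition concave_on (D : set R) f : Prop :=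
  @convex_function R R^o D (fun x => - f x).

(* inf J and sup J are taken in the extended reals, as J may be unbounded.
   The last case is meant for 0 < s <= 1. *)
Definition bi_concave s F : Prop :=
  if s < 0 then
    econvex (fun x => epow (F x) s) /\ econvex (fun x => epow (1 - F x) s)
  else if s == 0 then
    econcave (fun x => lne (F x)%:E) /\ econcave (fun x => lne (1 - F x)%:E)
  else
    concave_on [set x | (ereal_inf (EFin @` J F) < x%:E)%E]
      (fun x => F x `^ s) /\
    concave_on [set x | (x%:E < ereal_sup (EFin @` J F))%E]
      (fun x => (1 - F x) `^ s).

(* F is continuous on R and differentiable on J F with derivative f there *)
Definition continuous_with_derivative F f : Prop :=
  continuous F /\ forall x, J F x -> is_derive x 1 F (f x).

Definition bi_concave_bounds s F f : Prop :=
  forall x y, J F x -> J F y ->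
    if s == 0 then
      F y <= F x * expR (f x / F x * (y - x)) /\
      F y >= 1 - (1 - F x) * expR (- (f x / (1 - F x) * (y - x)))
    else
      ((F y)%:E <=
        (F x)%:E * epow (pospart (1 + s * (f x / F x) * (y - x))) s^-1)%E /\
      ((F y)%:E >=
        1 - (1 - F x)%:E *
              epow (pospart (1 - s * (f x / (1 - F x)) * (y - x))) s^-1)%E.

Definition hazard s F f (x : R) : R := f x / (1 - F x) `^ (1 - s).

Definition rev_hazard s F f (x : R) : R := f x / F x `^ (1 - s).

(* f' is the L1-derivative of f on the interval D *)
Definition L1_derivative (D : set R) f f' : Prop :=
  forall x y, D x -> D y -> x <= y ->
    (@lebesgue_measure R).-integrable `[x, y] (EFin \o f') /\
    f y - f x = \int[@lebesgue_measure R]_(t in `[x, y]) f' t.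

(* f' = F'' is both the pointwise a.e. derivative and the L1-derivative of f.
   The latter excludes a singular part of f: adding to a constant density an
   increasing continuous singular function leaves f' = 0 a.e., hence the
   bounds, unchanged but destroys bi-s-concavity. *)
Definition second_derivative_bounds s F f : Prop :=
  exists f' : R -> R,
    L1_derivative (J F) f f' /\
    {ae @lebesgue_measure R, forall x, J F x ->
       is_derive x 1 f (f' x) /\
       - (1 - s) * (f x ^+ 2 / (1 - F x)) <= f' x
         <= (1 - s) * (f x ^+ 2 / F x)}.

End bi_s_concave.

(* Main.v *)
(* Let U be ln if s = 0 and u^s / s otherwise, a primitive of u^(s-1). F is
   bi-s-concave iff U o F and U o (1 - F) are concave, and the second condition
   is the first one for the reflection x |-> 1 - F (- x), so only one half of
   each statement has to be treated.
   - Supergradients of the two concave functions give a differentiable majorant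
     and a differentiable minorant of F touching F at a given point, so F is
     differentiable there and the supergradient of U o F is f / F^(1-s): this
     is (ii). Adding the tangent inequalities at x and y gives (iii).
   - Under (iii), f is locally Lipschitz, because f is F^(1-s) times a
     nonincreasing function and (1 - F)^(1-s) times a nondecreasing one. A
     Lipschitz function is the integral of its almost everywhere derivative:
     its Lebesgue-Stieltjes measure (after adding a linear function) is
     dominated by the Lebesgue measure, and Radon-Nikodym and Lebesgue's
     differentiation theorem apply. The bounds of (iv) say that the hazard
     functions have derivatives of the right sign.
   - Under (iv), the bounds on f' integrate to bounds on the difference
     quotients of f near every point, so the upper derivative of f / F^(1-s) is
     everywhere at most 0 and this function is nonincreasing; being the
     derivative of U o F, it makes U o F concave. *)
Require Import Defs.
From HB Require Import structures.
From mathcomp Require Import all_boot all_order all_algebra.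
From mathcomp Require Import all_classical all_reals all_analysis.
From mathcomp Require Import measurable_realfun lra ring.
Import Order.TTheory GRing.Theory Num.Theory.
Import numFieldNormedType.Exports.
Local Open Scope classical_set_scope.
Local Open Scope ring_scope.

Set Implicit Arguments.
Unset Strict Implicit.
Unset Printing Implicit Defensive.

(** * Lipschitz functions are integrals of their derivatives *)

(** A Lebesgue-null set is covered by half-open intervals of arbitrarily small total length, and [g]
    stretches the length of each by a factor at most [K]. *)
Lemma lipschitz_cumulative_dominates (R : realType) (g : cumulative R R)
    (K : R) :
  (forall x y, x <= y -> g y - g x <= K * (y - x)) ->
  lebesgue_stieltjes_measure g `<< lebesgue_measure.
Proof.
move=> gK N N0 A mA AN.
have K0 : 0 <= K.
  have := gK 0 1 ler01; rewrite subr0 mulr1; apply: le_trans.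
  by rewrite subr_ge0; exact: cumulative_is_nondecreasing.
have gid (B : set (ocitv_type R)) : ocitv B ->
    (wlength g B <= K%:E * wlength idfun B)%E.
  move=> /ocitvP[->|[[a b] /= ab ->]]; first by rewrite !wlength0 mule0.
  have ba := ltW ab; rewrite !wlength_itv_bnd// lee_fin; exact: gK.
apply/eqP; rewrite eq_le measure_ge0 andbT.
apply/lee_addgt0Pr => e e0; rewrite add0e.
(* The denominator is [K + 1] because [K] may be 0. *)
have : (mu_ext (wlength (@idfun R)) A < (e / (K + 1))%:E)%E.
  rewrite [ltLHS](N0 A mA AN) lte_fin divr_gt0// ltr_wpDl//.
move=> /ereal_inf_lt[_ [B [mB AB] <-]] Be.
apply: (@le_trans _ _ (\sum_(k <oo) wlength g (B k))%E).
  by apply: ereal_inf_lbound; exists B.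
apply: (@le_trans _ _ (\sum_(k <oo) (K%:E * wlength idfun (B k)))%E).
  apply: lee_nneseries => [k _ _|k _]; first exact: wlength_ge0.
  exact/gid/mB.
rewrite nneseriesZl; last by move=> k _; exact: wlength_ge0.
apply: (@le_trans _ _ (K%:E * (e / (K + 1))%:E)%E).
  by apply: lee_wpmul2l; [rewrite lee_fin|exact: ltW].
rewrite -EFinM lee_fin mulrCA ler_piMr ?ltW//.
by rewrite ltr_pdivrMr ?ltr_wpDl// mul1r ltrDl.
Qed.

(* rho is the Radon-Nikodym derivative of the Lebesgue-Stieltjes measure of
   g. *)
Lemma lipschitz_cdf_density (R : realType)
    (g : cumulativeBounded (0 : R) (1 : R)) (K : R) :
  (forall x y, x <= y -> g y - g x <= K * (y - x)) ->
  exists2 rho : R -> R,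
    lebesgue_measure.-integrable setT (EFin \o rho) &
    forall x y, x <= y ->
      g y - g x = \int[lebesgue_measure]_(t in `[x, y]) rho t.
Proof.
move=> gK; have gmu := lipschitz_cumulative_dominates gK.
have rho_fin := Radon_Nikodym_SigmaFinite.f_fin_num gmu.
have irho := Radon_Nikodym_SigmaFinite.f_integrable gmu.
have := Radon_Nikodym_SigmaFinite.f_integral gmu.
set rho := Radon_Nikodym_SigmaFinite.f _ _ in rho_fin irho *.
move=> nuE.
have rhoE : EFin \o (fine \o rho) = rho.
  by apply/funext => t /=; rewrite fineK.
exists (fine \o rho); first by rewrite rhoE.
move=> x y xy.
have : (g y - g x)%:E = lebesgue_stieltjes_measure g `]x, y].
  rewrite /lebesgue_stieltjes_measure /measure_extension.
  by rewrite measurable_mu_extE/= ?wlength_itv_bnd//; exact: is_ocitv.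
rewrite nuE//= => rhoxy; rewrite -Rintegral_itv_obnd_cbnd; last first.
  by rewrite rhoE; exact: (integrableS measurableT).
rewrite /Rintegral -[LHS]/(fine (g y - g x)%:E) rhoxy.
by congr fine; apply: eq_integral => t _; rewrite /= fineK.
Qed.

(** The primitive of [rho] from [-oo] differs from [g] by a constant, and Lebesgue's theorem
    differentiates it almost everywhere. *)
Lemma lipschitz_cdf_ae_derive (R : realType)
    (g : cumulativeBounded (0 : R) (1 : R)) (K : R) :
  (forall x y, x <= y -> g y - g x <= K * (y - x)) ->
  exists rho : R -> R,
    [/\ lebesgue_measure.-integrable setT (EFin \o rho),
        forall x y, x <= y ->
          g y - g x = \int[lebesgue_measure]_(t in `[x, y]) rho t &
        {ae @lebesgue_measure R, forall x : R, is_derive x 1 g (rho x)}].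
Proof.
move=> gK; have [rho irho rhoE] := lipschitz_cdf_density gK.
exists rho; split => //.
have irhoD D : measurable D -> lebesgue_measure.-integrable D (EFin \o rho).
  by move=> mD; exact: (integrableS measurableT).
have /FTC1Ny : forall y, lebesgue_measure.-integrable `]-oo, y] (EFin \o rho).
  by move=> y; exact: irhoD.
have /[swap]/[apply] : locally_integrable [set: R] rho.
  by apply: open_integrable_locally => //; exact: openT.
set G := fun x => _.
have GB x y : x <= y -> G y - G x = g y - g x.
  move=> xy; rewrite rhoE// Rintegral_itvB//; last exact: irhoD.
  by rewrite Rintegral_itv_obnd_cbnd//; exact: irhoD.
have gE : g = (fun y => G y + (g 0 - G 0)) :> (R -> R).
  apply/funext => y.
  by case: (leP 0 y) => [/GB|/ltW/GB]; lra.
apply: filterS; first exact: (ae_filter_ringOfSetsType lebesgue_measure).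
move=> x [dG Gx].
rewrite gE -[rho x]addr0; apply: (@is_deriveD _ _ _ G (cst (g 0 - G 0))).
by rewrite -Gx derive1E; exact/derivableP.
Qed.

Lemma lipschitz_cont (R : realType) (f : R -> R) (K : R) :
  (forall x y, x <= y -> `|f y - f x| <= K * (y - x)) -> continuous f.
Proof.
move=> fK x; apply/(@cvgrPdist_lt R R) => e e0.
have K0 : 0 <= K.
  by have := fK 0 1 ler01; rewrite subr0 mulr1; exact: le_trans.
exists (e / (K + 1)); first by rewrite /= divr_gt0// ltr_wpDl.
move=> y /= xy; apply: (@le_lt_trans _ _ (K * `|x - y|)).
  case: (leP x y) => [xley|/ltW ylex].
    by rewrite distrC (distrC x) (ger0_norm (_ : 0 <= y - x)) ?subr_ge0// fK.
  by rewrite (ger0_norm (_ : 0 <= x - y)) ?subr_ge0// fK.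
apply: (@le_lt_trans _ _ (K * (e / (K + 1)))); first by rewrite ler_wpM2l// ltW.
by rewrite mulrCA gtr_pMr// ltr_pdivrMr ?ltr_wpDl// mul1r ltrDl.
Qed.

(** Serves to undo the affine normalisation of a density; [B = 0] and [B = -1] give constants and a
    change of sign. *)
Lemma Rintegral_itv_affine (R : realType) (rho : R -> R) (B L x y : R) :
  x <= y ->
  lebesgue_measure.-integrable `[x, y] (EFin \o rho) ->
  lebesgue_measure.-integrable `[x, y] (EFin \o (fun t => B * rho t - L)) /\
  \int[lebesgue_measure]_(t in `[x, y]) (B * rho t - L) =
    B * \int[lebesgue_measure]_(t in `[x, y]) rho t - L * (y - x).
Proof.
set mu := @lebesgue_measure R => xy irho.
have mD : measurable `[x, y]%classic by exact: measurable_itv.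
have iL : mu.-integrable `[x, y] (EFin \o @cst R R L).
  apply: continuous_compact_integrable; first exact: segment_compact.
  by apply: continuous_subspaceT => z; exact: cvg_cst.
have iBrho : mu.-integrable `[x, y] (EFin \o (fun t => B * rho t)).
  exact: (@integrableZl _ _ _ mu _ mD B _ irho).
split; first exact: (@integrableB _ _ _ mu _ mD _ _ iBrho iL).
rewrite (@RintegralB _ _ _ mu _ _ _ mD iBrho iL).
rewrite (@RintegralZl _ _ _ mu _ _ B mD irho) (@Rintegral_cst _ _ _ mu _ mD).
have := @lebesgue_measure_itv R `[x, y]; rewrite -/mu /= lte_fin => muE.
congr (_ - _ * _); rewrite [X in fine X]muE; case: ltP => [//|yx].
by have -> : x = y; [lra|rewrite subrr].
Qed.

(** * Lipschitz functions on a compact interval *)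

(** For [c < d], the projection onto [[c, d]]. Composing with it extends a function from [[c, d]] to
    the line with the same Lipschitz constant. *)
Definition clamp (R : realType) (c d x : R) : R :=
  if x <= c then c else if d <= x then d else x.

Lemma clamp_itv (R : realType) (c d x : R) : c < d -> c <= clamp c d x <= d.
Proof. by rewrite /clamp => cd; case: (leP x c); case: (leP d x); lra. Qed.

Lemma clamp_id (R : realType) (c d x : R) :
  c < d -> c <= x <= d -> clamp c d x = x.
Proof. by rewrite /clamp => cd; case: (leP x c); case: (leP d x); lra. Qed.

Lemma clamp_le (R : realType) (c d x y : R) :
  c < d -> x <= y -> 0 <= clamp c d y - clamp c d x <= y - x.
Proof.
rewrite /clamp => cd xy.
by case: (leP x c); case: (leP d x); case: (leP y c); case: (leP d y); lra.
Qed.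

Lemma lipschitz_nondecreasing_ae_derive (R : realType) (g : R -> R) (K : R) :
  {homo g : x y / x <= y} ->
  (forall x y, x <= y -> g y - g x <= K * (y - x)) ->
  g @ -oo --> (0 : R) -> g @ +oo --> (1 : R) ->
  exists rho : R -> R,
    [/\ lebesgue_measure.-integrable setT (EFin \o rho),
        forall x y, x <= y ->
          g y - g x = \int[lebesgue_measure]_(t in `[x, y]) rho t &
        {ae @lebesgue_measure R, forall x : R, is_derive x 1 g (rho x)}].
Proof.
move=> gnd gK g0 g1.
have gc : continuous g.
  apply: (@lipschitz_cont _ _ K) => x y xy.
  by rewrite ger0_norm ?gK// subr_ge0 gnd.
have grc : right_continuous g by exact: right_continuousW.
pose G : cumulativeBounded (0 : R) (1 : R) :=
  HB.pack g (isCumulative.Build R _ R g gnd grc)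
    (isCumulativeBounded.Build R 0 1 g g0 g1).
exact: (@lipschitz_cdf_ae_derive _ G K).
Qed.

(** Adding a line of slope [L > K] makes [f] increasing. Clamped to [[c, d]] and divided by its
    total increase [B], the sum is a distribution function [g], whose density determines that of
    [f]. *)
Lemma lipschitz_ae_derive (R : realType) (f : R -> R) (c d K : R) :
  c < d ->
  (forall x y, c <= x -> x <= y -> y <= d ->
    `|f y - f x| <= K * (y - x)) ->
  exists rho : R -> R,
    [/\ lebesgue_measure.-integrable `[c, d] (EFin \o rho),
        forall x y, c <= x -> x <= y -> y <= d ->
          f y - f x = \int[lebesgue_measure]_(t in `[x, y]) rho t &
        {ae @lebesgue_measure R, forall x : R, c < x < d ->
          is_derive x 1 f (rho x)}].
Proof.
move=> cd fK.
have K0 : 0 <= K.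
  have := fK c d (lexx _) (ltW cd) (lexx _); move/(le_trans (normr_ge0 _)).
  by rewrite pmulr_lge0// subr_gt0.
(* With slope [K] the total increase [B] would vanish for [f] of slope [-K]. *)
pose L := K + 1; pose B := f d - f c + L * (d - c).
have B0 : 0 < B.
  have := fK c d (lexx _) (ltW cd) (lexx _).
  by rewrite ler_norml /B /L => /andP[+ _]; nra.
pose cl := clamp c d.
pose g x := (f (cl x) - f c + L * (cl x - c)) / B.
have gB x y : x <= y -> 0 <= g y - g x <= (K + L) / B * (y - x).
  move=> xy; have /andP[xy0 xy1] : 0 <= cl y - cl x <= y - x := clamp_le cd xy.
  have /andP[cx xd] : c <= cl x <= d := clamp_itv x cd.
  have /andP[cy yd] : c <= cl y <= d := clamp_itv y cd.
  rewrite /g -mulrBl mulrAC; rewrite subr_ge0 in xy0.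
  have := fK _ _ cx xy0 yd; rewrite ler_norml => /andP[h1 h2].
  apply/andP; split.
    by apply: divr_ge0; [rewrite /L in h1 *; nra|exact: ltW].
  by rewrite ler_pM2r ?invr_gt0// /L; nra.
have gnd : {homo g : x y / x <= y} by move=> x y /gB; lra.
have g0 : g @ -oo --> (0 : R).
  apply: cvg_near_cst; exists c; split; first exact: num_real.
  move=> x /= xc; have : cl x = c by rewrite /cl /clamp ltW.
  by rewrite /g => ->; rewrite !subrr mulr0 addr0 mul0r.
have g1 : g @ +oo --> (1 : R).
  apply: cvg_near_cst; exists d; split; first exact: num_real.
  move=> x /= dx; have : cl x = d.
    by rewrite /cl /clamp (ltW dx) leNgt (lt_trans cd dx).
  by rewrite /g => ->; rewrite divff// gt_eqF.
have gK x y : x <= y -> g y - g x <= (K + L) / B * (y - x) by move=> /gB/andP[].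
have [rho [irho rhoE drho]] := lipschitz_nondecreasing_ae_derive gnd gK g0 g1.
have irhoI x y : lebesgue_measure.-integrable `[x, y] (EFin \o rho).
  exact: (integrableS measurableT).
have fE x : c <= x -> x <= d -> f x = B * g x + (f c - L * (x - c)).
  by move=> cx xd; rewrite /g /cl clamp_id ?cx// mulrC divfK ?gt_eqF//; lra.
exists (fun t => B * rho t - L); split.
- by have [] := Rintegral_itv_affine B L (ltW cd) (irhoI c d).
- move=> x y cx xy yd.
  have [_ rhoxy] := Rintegral_itv_affine B L xy (irhoI x y).
  apply: etrans (esym rhoxy).
  rewrite -(rhoE _ _ xy).
  rewrite (fE _ (le_trans cx xy) yd) (fE _ cx (le_trans xy yd)).
  by clear; ring.
- have aef := ae_filter_ringOfSetsType (@lebesgue_measure R).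
  apply: (@filterS _ _ aef _ _ _ drho) => x dg /andP[cx xd].
  (* The expression of [f] through [g] is valid on [[c, d]] only, hence near the interior point
     [x]. *)
  apply: (@near_eq_is_derive _ _ _ (fun x => B * g x + (f c - L * (x - c)))).
    near=> y; rewrite [RHS]fE //; apply: ltW.
      by near: y; exact: lt_nbhsr.
    by near: y; exact: lt_nbhsl.
  have -> : B * rho x - L = B * rho x + (0 - L * (1 - 0)) by lra.
  exact: (@is_deriveD _ _ _ (B \*: (g : R -> R^o))).
Unshelve. all: by end_near.
Qed.

(** * A measurable version of the derivative *)

Definition diff_quot (R : realType) (f : R -> R) (n : nat) (x : R) : R :=
  n.+1%:R * (f (x + n.+1%:R^-1) - f x).

(* Equal to the derivative of f wherever it exists, and Borel measurable
   everywhere, as L1_derivative requires. *)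
Definition limsup_diff_quot (R : realType) (f : R -> R) (x : R) : R :=
  fine (limn_esup (fun n => (diff_quot f n x)%:E)).

(** The quotient of index [n] is the Caratheodory slope at [x + 1/(n+1)], and this slope is
    continuous at [x]. The second function [g] stands for the extension of [f] by 0 outside an open
    set. *)
Lemma limsup_diff_quot_derive (R : realType) (f g : R -> R) (x a : R) :
  (\forall y \near x, f y = g y) -> is_derive x 1 f a ->
  limsup_diff_quot g x = a.
Proof.
move=> fg /is_derive1_caratheodory[phi [fphi cphi phix]].
have xn : x + n.+1%:R^-1 @[n --> \oo] --> x.
  rewrite -[X in _ --> X]addr0; apply: cvgD; first exact: cvg_cst.
  exact: cvg_harmonic.
have : diff_quot g n x @[n --> \oo] --> a.
  rewrite -phix; apply: cvg_trans (cvg_comp _ _ xn cphi).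
  apply: near_eq_cvg.
  have {}xn : \forall n \near \oo, f (x + n.+1%:R^-1) = g (x + n.+1%:R^-1).
    exact: xn _ fg.
  near=> n; have fgn : f (x + n.+1%:R^-1) = g (x + n.+1%:R^-1) by near: n.
  rewrite /= /diff_quot -fgn.
  rewrite -(nbhs_singleton fg) fphi addrAC subrr add0r.
  by rewrite mulrC -mulrA mulVf ?mulr1.
move=> qa; rewrite /limsup_diff_quot.
have [|_ ->//] := @cvg_limn_einf_sup _ (fun n => (diff_quot g n x)%:E) a%:E.
by apply: cvg_EFin => //; exact: nearW.
Unshelve. all: by end_near.
Qed.

Lemma measurable_limsup_diff_quot (R : realType) (f : R -> R) :
  measurable_fun setT f -> measurable_fun setT (limsup_diff_quot f).
Proof.
move=> mf.
have mdq n : measurable_fun setT (diff_quot f n).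
  apply: measurable_funM => //; apply: measurable_funB => //.
  by apply: (measurableT_comp mf); exact: measurable_funD.
apply: (measurableT_comp (@fine_measurable R setT measurableT)).
by apply: measurable_fun_limn_esup => n; exact/measurable_EFinP.
Qed.

(** Exchanges a density for an almost everywhere equal one: first for a derivative common to all
    intervals, later for a truncation. *)
Lemma ae_eq_Rintegral_itv (R : realType) (g rho : R -> R) (x y : R) :
  measurable_fun `[x, y]%classic g ->
  lebesgue_measure.-integrable `[x, y] (EFin \o rho) ->
  {ae @lebesgue_measure R, forall t : R, x <= t <= y -> rho t = g t} ->
  lebesgue_measure.-integrable `[x, y] (EFin \o g) /\
  \int[lebesgue_measure]_(t in `[x, y]) rho t =
    \int[lebesgue_measure]_(t in `[x, y]) g t.
Proof.
set mu := @lebesgue_measure R => mg irho rhog.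
have mD : measurable `[x, y]%classic by exact: measurable_itv.
have /integrableP[mrho rhooo] := irho.
have mg' : measurable_fun `[x, y] (EFin \o g).
  exact/measurable_EFinP.
have eg : ae_eq mu `[x, y]%classic (EFin \o rho) (EFin \o g).
  apply: (@filterS _ _ (ae_filter_ringOfSetsType mu) _ _ _ rhog) => t rg /=.
  by rewrite in_itv/= => /rg ->.
split; last first.
  rewrite /Rintegral.
  by rewrite (@ae_eq_integral _ _ _ mu _ (EFin \o g) _ mD mrho mg' eg).
apply/integrableP; split => //; move: rhooo.
rewrite (@ae_eq_integral _ _ _ mu _ (fun t => `|(EFin \o g) t|%E)) //.
- exact/measurableT_comp.
- exact/measurableT_comp.
- exact: (ae_eq_abse eg).
Qed.

(** * Locally Lipschitz functions on an open set *)

Lemma open_itv_nbhs (R : realType) (D : set R) (x : R) : open D -> D x ->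
  exists c d, [/\ D c, D d, c < x & x < d].
Proof.
move=> oD Dx; have := open_nbhs_nbhs (conj oD Dx).
move=> /nbhs_ballP[e /= e0 xeD]; exists (x - e / 2), (x + e / 2).
have e20 : 0 < e / 2 by rewrite divr_gt0.
split; [| |lra|lra]; apply: xeD; rewrite /ball/=.
  by rewrite opprD opprK addrA subrr add0r gtr0_norm//; lra.
by rewrite opprD addrA subrr sub0r normrN gtr0_norm//; lra.
Qed.

(** Near [x], [f] coincides with [f \o clamp c d], which is Lipschitz on the whole line. *)
Lemma locally_lipschitz_continuous (R : realType) (D : set R) (f : R -> R) :
  open D ->
  (forall c d, D c -> D d -> c < d -> exists K, forall x y,
    c <= x -> x <= y -> y <= d -> `|f y - f x| <= K * (y - x)) ->
  forall x, D x -> {for x, continuous f}.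
Proof.
move=> oD fK x Dx; have [c [d [Dc Dd cx xd]]] := open_itv_nbhs oD Dx.
have cd := lt_trans cx xd; have [K fcdK] := fK c d Dc Dd cd.
have K0 : 0 <= K.
  have /(le_trans (normr_ge0 _)) := fcdK c d (lexx _) (ltW cd) (lexx _).
  by rewrite pmulr_lge0// subr_gt0.
have /(_ x) : continuous (f \o clamp c d).
  apply: (@lipschitz_cont _ _ K) => u v uv /=.
  have /andP[cu ud] := clamp_itv u cd; have /andP[cv vd] := clamp_itv v cd.
  have /andP[uv0 uv1] := clamp_le cd uv; rewrite subr_ge0 in uv0.
  by apply: le_trans (fcdK _ _ cu uv0 vd) _; rewrite ler_wpM2l.
rewrite /continuous_at /= clamp_id ?(ltW cx) ?(ltW xd)//.
apply: cvg_trans; apply: near_eq_cvg.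
have := lt_nbhsl xd; have := lt_nbhsr cx; apply: filterS2 => y cy yd.
by rewrite /= clamp_id// !ltW.
Qed.

(** The densities obtained on the various compact intervals all agree almost everywhere with one
    function [f']. Differentiability is pasted together from countably many intervals with rational
    endpoints. *)
Lemma locally_lipschitz_L1_derivative (R : realType) (D : set R) (f : R -> R) :
  open D -> is_interval D ->
  (forall c d, D c -> D d -> c < d -> exists K, forall x y,
    c <= x -> x <= y -> y <= d -> `|f y - f x| <= K * (y - x)) ->
  exists f', L1_derivative D f f' /\
    {ae @lebesgue_measure R, forall x : R, D x -> is_derive x 1 f (f' x)}.
Proof.
move=> oD iD fK.
have cf : {in D, continuous f}.
  by move=> x /set_mem; exact: locally_lipschitz_continuous.
(* Extended by 0, [f] is measurable on the whole line, and [f'] does not depend on the intervals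
   chosen below. *)
pose fD := f \_ D; pose f' := limsup_diff_quot fD.
have mf' : measurable_fun [set: R] f'.
  apply: measurable_limsup_diff_quot; apply/(measurable_restrictT _ _).1.
    exact: open_measurable.
  exact: open_continuous_measurable_fun.
have f'E (x a : R) : D x -> is_derive x 1 f a -> f' x = a.
  move=> Dx; apply: limsup_diff_quot_derive.
  near=> y; rewrite /fD patchE ifT// inE.
  by near: y; exact: open_nbhs_nbhs.
have key (c d : R) : D c -> D d -> c < d ->
  {ae @lebesgue_measure R, forall x : R, c < x < d -> is_derive x 1 f (f' x)} /\
  (forall x y : R, c < x -> x <= y -> y < d ->
    lebesgue_measure.-integrable `[x, y] (EFin \o f') /\
    f y - f x = \int[lebesgue_measure]_(t in `[x, y]) f' t).
  move=> Dc Dd cd; have [K fcdK] := fK c d Dc Dd cd.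
  have aef := ae_filter_ringOfSetsType (@lebesgue_measure R).
  have [rho [irho rhoE drho]] := lipschitz_ae_derive cd fcdK.
  have f'rho x : c < x < d -> is_derive x 1 f (rho x) -> f' x = rho x.
    move=> /andP[cx xd]; apply: f'E; apply: (iD c d) => //.
    by rewrite !ltW.
  split=> [|x y cx xy yd].
    apply: (@filterS _ _ aef _ _ _ drho) => x dx cxd.
    by rewrite (f'rho x cxd (dx cxd)); exact: dx.
  rewrite rhoE ?(ltW cx) ?(ltW yd)//; apply: ae_eq_Rintegral_itv.
    exact: measurable_funTS.
    apply: integrableS irho => //.
    by move=> z /=; rewrite !in_itv/= => /andP[xz zy]; apply/andP; split; lra.
  apply: (@filterS _ _ aef _ _ _ drho) => z dz /andP[xz zy].
  have cdz : c < z < d by rewrite (lt_le_trans cx xz) (le_lt_trans zy yd).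
  by rewrite (f'rho z cdz (dz cdz)).
exists f'; split.
  move=> x y Dx Dy xy.
  have [c [_ [Dc _ cx _]]] := open_itv_nbhs oD Dx.
  have [_ [d [_ Dd _ yd]]] := open_itv_nbhs oD Dy.
  have cd : c < d by exact: lt_le_trans cx (le_trans xy (ltW yd)).
  by have [_ keyxy] := key c d Dc Dd cd; exact: keyxy.
(* [n] encodes a pair of rationals, so that only countably many null sets are discarded; codes of no
   use make [P] trivially true. *)
pose P n (x : R) := if unpickle n is Some (p, q)%type then
  D (ratr p) -> D (ratr q) -> ratr p < x < ratr q -> is_derive x 1 f (f' x)
  else True.
have : {ae @lebesgue_measure R, forall x n, P n x}.
  apply: (@ae_foralln _ _ _ (@lebesgue_measure R)) => n.
  rewrite /P; case: unpickle => [[p q]|]; last exact: aeW.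
  have [[Dp [Dq pq]]|npq] := pselect (D (ratr p) /\ D (ratr q) /\
      (ratr p : R) < ratr q).
    have [h _] := key _ _ Dp Dq pq.
    have aef := ae_filter_ringOfSetsType (@lebesgue_measure R).
    by apply: (@filterS _ _ aef _ _ _ h) => x hx _ _.
  apply: aeW => x Dp Dq /andP[px xq]; exfalso; apply: npq; split => //.
  by split => //; exact: lt_trans px xq.
apply: filterS; first exact: (ae_filter_ringOfSetsType (@lebesgue_measure R)).
move=> x Px Dx.
have [c [d [Dc Dd cx xd]]] := open_itv_nbhs oD Dx.
have /rat_in_itvoo[p] := cx; rewrite inE/= => /andP[cp px].
have /rat_in_itvoo[q] := xd; rewrite inE/= => /andP[xq qd].
have := Px (pickle (p, q)); rewrite /P pickleK; apply.
- by apply: (iD c x) => //; rewrite (ltW cp) (ltW px).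
- by apply: (iD x d) => //; rewrite (ltW xq) (ltW qd).
- by apply/andP; split.
Unshelve. all: by end_near.
Qed.

(** * Integration of almost everywhere bounds *)

(** [g] is replaced by its truncation at [C], which equals it almost everywhere on the interval and
    satisfies the bound at every point. *)
Lemma Rintegral_itv_ae_le (R : realType) (g : R -> R) (C x y : R) :
  x <= y -> lebesgue_measure.-integrable `[x, y] (EFin \o g) ->
  {ae @lebesgue_measure R, forall t : R, x <= t <= y -> g t <= C} ->
  \int[lebesgue_measure]_(t in `[x, y]) g t <= C * (y - x).
Proof.
move=> xy ig gC; have aef := ae_filter_ringOfSetsType (@lebesgue_measure R).
have /integrableP[/measurable_EFinP mg _] := ig.
have [||ih ->] := @ae_eq_Rintegral_itv _ (fun t => Num.min (g t) C) _ _ _ _ ig.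
- exact: measurable_minr.
- apply: (@filterS _ _ aef _ _ _ gC) => t gt xty.
  by apply/esym/min_idPl/gt.
(* The constant [C] is written as [0 * g t - - C]. *)
have [i0 E0] := Rintegral_itv_affine 0 (- C) xy ig.
apply: (@le_trans _ _ (\int[lebesgue_measure]_(t in `[x, y]) (0 * g t - - C))).
  apply: le_Rintegral => //.
  by move=> t _; rewrite mul0r add0r opprK ge_min lexx orbT.
by rewrite E0; lra.
Qed.

Lemma Rintegral_itv_ae_ge (R : realType) (g : R -> R) (C x y : R) :
  x <= y -> lebesgue_measure.-integrable `[x, y] (EFin \o g) ->
  {ae @lebesgue_measure R, forall t : R, x <= t <= y -> C <= g t} ->
  C * (y - x) <= \int[lebesgue_measure]_(t in `[x, y]) g t.
Proof.
move=> xy ig gC; have aef := ae_filter_ringOfSetsType (@lebesgue_measure R).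
have [i1 E1] := Rintegral_itv_affine (-1) 0 xy ig.
have := Rintegral_itv_ae_le xy i1 (C := - C); rewrite E1.
suff h : {ae @lebesgue_measure R, forall t : R, x <= t <= y ->
  -1 * g t - 0 <= - C}.
  by move=> /(_ h); lra.
by apply: (@filterS _ _ aef _ _ _ gC) => t gt /gt; lra.
Qed.

(** * Power transforms and supergradients *)

(** This form is free of division, so that comparing derivatives reduces to linear inequalities at a
    nearby point. *)
Lemma is_derive1P (R : realType) (f : R -> R) (x a : R) :
  is_derive x 1 f a <->
  forall e, 0 < e ->
    \forall y \near x, `|f y - f x - a * (y - x)| <= e * `|y - x|.
Proof.
split=> [/is_derive1_caratheodory[g [fg cg gx]] e e0|h].
  have /cvgrPdist_le/(_ e e0) := cg; apply: filterS => y ge.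
  rewrite fg -gx -mulrBl normrM distrC ler_wpM2r//.
apply/is_derive1_caratheodory.
exists (fun z => if z == x then a else (f z - f x) / (z - x)); split.
- move=> z; case: eqVneq => [->|zx]; first by rewrite !subrr mulr0.
  by rewrite divfK// subr_eq0.
- apply/cvgrPdist_le => e e0; have := h e e0; apply: filterS => y fe.
  rewrite eqxx; case: eqVneq => [_|yx]; first by rewrite subrr normr0 ltW.
  have yx0 : 0 < `|y - x| by rewrite normr_gt0 subr_eq0.
  rewrite -(ler_pM2r yx0) -normrM mulrBl divfK ?subr_eq0// distrC//.
- by rewrite eqxx.
Qed.

Lemma near_gt_exists (R : realType) (P : R -> Prop) (x : R) :
  (\forall y \near x, P y) -> exists2 y, x < y & P y.
Proof.
move=> /nbhs_ballP[e /= e0 xP]; exists (x + e / 2).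
  by rewrite ltrDl divr_gt0.
by apply: xP; rewrite /ball/= opprD addrA subrr sub0r normrN gtr0_norm; lra.
Qed.

Lemma near_lt_exists (R : realType) (P : R -> Prop) (x : R) :
  (\forall y \near x, P y) -> exists2 y, y < x & P y.
Proof.
move=> /nbhs_ballP[e /= e0 xP]; exists (x - e / 2).
  by rewrite ltrBlDl ltrDr divr_gt0.
by apply: xP; rewrite /ball/= opprD opprK addrA subrr add0r gtr0_norm; lra.
Qed.

(** The difference [u - l] is nonnegative near [x] and vanishes at [x]: a point on the right gives
    [a <= b], a point on the left [b <= a]. *)
Lemma squeeze_derive (R : realType) (l f u : R -> R) (x a b : R) :
  (\forall y \near x, l y <= f y <= u y) -> l x = f x -> u x = f x ->
  is_derive x 1 l a -> is_derive x 1 u b -> a = b /\ is_derive x 1 f a.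
Proof.
move=> lfu lx ux /is_derive1P la /is_derive1P ub.
have ab : a = b.
  apply/eqP; rewrite eq_le; apply/andP; split; apply/ler_addgt0Pr => e e0.
    have e20 : 0 < e / 2 by rewrite divr_gt0.
    have [y xy [/andP[lf fu] [hl hu]]] :=
      near_gt_exists (filterI lfu (filterI (la _ e20) (ub _ e20))).
    move: hl hu; rewrite (gtr0_norm (_ : 0 < y - x)) ?subr_gt0// !ler_norml.
    move=> /andP[hl _] /andP[_ hu].
    by rewrite -(@ler_pM2r _ (y - x)) ?subr_gt0//; lra.
  have e20 : 0 < e / 2 by rewrite divr_gt0.
  have [y xy [/andP[lf fu] [hl hu]]] :=
    near_lt_exists (filterI lfu (filterI (la _ e20) (ub _ e20))).
  move: hl hu; rewrite (ltr0_norm (_ : y - x < 0)) ?subr_lt0// !ler_norml.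
  move=> /andP[hl _] /andP[_ hu].
  by rewrite -(@ler_pM2r _ (x - y)) ?subr_gt0//; lra.
split=> //; apply/is_derive1P => e e0.
apply: filterS (filterI lfu (filterI (la _ e0) (ub _ e0))).
move=> y [/andP[lf fu] [hl hu]]; move: hl hu.
by rewrite -ab !ler_norml; lra.
Qed.

(* A primitive of u |-> u^(s-1), concave on ]0, +oo[ when s <= 1. *)
Definition power_transform (R : realType) (s u : R) : R :=
  if s == 0 then ln u else u `^ s / s.

Lemma is_derive_powR (R : realType) (s u : R) : 0 < u ->
  is_derive u 1 (fun v => v `^ s) (s * u `^ (s - 1)).
Proof.
move=> u0; have ui : u \in `]0, +oo[ by rewrite in_itv/= u0.
rewrite -(powR_derive1 s ui) derive1E; apply/derivableP.
exact: derivable_powR.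
Qed.

Lemma is_derive_power_transform (R : realType) (s u : R) : 0 < u ->
  is_derive u 1 (power_transform s) (u `^ (s - 1)).
Proof.
move=> u0; rewrite /power_transform; have [->|s0] := eqVneq s 0.
  rewrite sub0r powR_inv1 ?ltW//; exact: is_derive1_ln.
have -> : u `^ (s - 1) = s^-1 * (s * u `^ (s - 1)) by rewrite mulKf.
rewrite (_ : (fun v => v `^ s / s) = s^-1 \*: (fun v => v `^ s : R^o)).
  by apply: is_deriveZ; exact: is_derive_powR.
by apply/funext => v; rewrite mulrC.
Qed.

Lemma power_transform_mvt (R : realType) (s u v : R) : 0 < u -> u < v ->
  exists2 c, u < c < v & power_transform s v - power_transform s u =
    c `^ (s - 1) * (v - u).
Proof.
move=> u0 uv.
have [||c] := @MVT _ (power_transform s) (fun c => c `^ (s - 1)) u v uv.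
- move=> c; rewrite in_itv/= => /andP[uc _].
  exact/is_derive_power_transform/(lt_trans u0).
- apply: derivable_within_continuous => c; rewrite in_itv/= => /andP[uc _].
  by have /@ex_derive := is_derive_power_transform s (lt_le_trans u0 uc).
by rewrite in_itv/= => ucv ->; exists c.
Qed.

Lemma power_transform_lt (R : realType) (s u v : R) : 0 < u -> u < v ->
  power_transform s u < power_transform s v.
Proof.
move=> u0 uv; have [c /andP[uc _] Uuv] := power_transform_mvt s u0 uv.
by rewrite -subr_gt0 Uuv mulr_gt0 ?subr_gt0// powR_gt0// (lt_trans u0).
Qed.

Lemma power_transform_le (R : realType) (s u v : R) : 0 < u -> u <= v ->
  power_transform s u <= power_transform s v.
Proof.
by move=> u0; rewrite le_eqVlt => /predU1P[->//|/(power_transform_lt s u0)/ltW].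
Qed.

(** The derivative [u^(s-1)] is at least 1 on []0, 1]]. Hence increments of [F] are controlled by
    those of its transform. *)
Lemma power_transform_expand (R : realType) (s u v : R) : s <= 1 ->
  0 < u -> u <= v -> v <= 1 ->
  v - u <= power_transform s v - power_transform s u.
Proof.
move=> s1 u0; rewrite le_eqVlt => /predU1P[->|uv v1]; first by rewrite !subrr.
have [c /andP[uc cv] ->] := power_transform_mvt s u0 uv.
rewrite ler_peMl ?subr_ge0 ?(ltW uv)//.
have c01 : 0 < c <= 1 by rewrite (lt_trans u0 uc) (le_trans (ltW cv) v1).
by rewrite -[leLHS](powRr0 c); apply: ger_powR => //; rewrite subr_le0.
Qed.

(** * Concave functions and supergradients *)

(** Concavity with weight [(z - y) / (z - x)], which produces [y] from [x] and [z], after clearing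
    denominators. *)
Lemma concave_slope (R : realType) (phi : R -> R) (D : set R) (x y z : R) :
  (forall x y t, D x -> D y -> 0 <= t <= 1 ->
    t * phi x + (1 - t) * phi y <= phi (t * x + (1 - t) * y)) ->
  D x -> D z -> x < y -> y < z ->
  (z - y) * phi x + (y - x) * phi z <= (z - x) * phi y.
Proof.
move=> phiD Dx Dz xy yz.
have xz : 0 < z - x by rewrite subr_gt0 (lt_trans xy yz).
have xz0 : z - x != 0 by rewrite gt_eqF.
have t01 : 0 <= (z - y) / (z - x) <= 1.
  rewrite divr_ge0 ?subr_ge0 ?(ltW yz) ?(ltW (lt_trans xy yz))//=.
  by rewrite ler_pdivrMr// mul1r lerD2l lerN2 ltW.
have := phiD x z _ Dx Dz t01.
have -> : (z - y) / (z - x) * x + (1 - (z - y) / (z - x)) * z = y by field.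
rewrite -(ler_pM2l xz); congr (_ <= _); by field.
Qed.

(** The supremum of the slopes to the right of [x] works: every slope to the left of [x] is an upper
    bound of them. Openness of [D] makes both families nonempty. *)
Lemma concave_supergradient (R : realType) (phi : R -> R) (D : set R) (x : R) :
  open D -> D x ->
  (forall x y t, D x -> D y -> 0 <= t <= 1 ->
    t * phi x + (1 - t) * phi y <= phi (t * x + (1 - t) * y)) ->
  exists p, forall y, D y -> phi y <= phi x + p * (y - x).
Proof.
move=> oD Dx phiD.
have [c [d [Dc Dd cx xd]]] := open_itv_nbhs oD Dx.
pose S := [set (phi z - phi x) / (z - x) | z in [set z | D z /\ x < z]].
have ubS y : D y -> y < x -> ubound S ((phi x - phi y) / (x - y)).
  move=> Dy yx _ [z [Dz xz] <-].
  have := concave_slope phiD Dy Dz yx xz.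
  rewrite ler_pdivrMr ?subr_gt0// mulrAC ler_pdivlMr ?subr_gt0//.
  by lra.
have S0 : S !=set0 by exists ((phi d - phi x) / (d - x)), d.
have hubS : has_ubound S by exists ((phi x - phi c) / (x - c)); exact: ubS.
exists (sup S) => y Dy; case: (ltrgtP y x) => [yx|xy|->].
- have : sup S <= (phi x - phi y) / (x - y).
    by apply: ge_sup => //; exact: ubS.
  by rewrite ler_pdivlMr ?subr_gt0//; lra.
- have : (phi y - phi x) / (y - x) <= sup S.
    by apply: ub_le_sup => //; exists y.
  by rewrite ler_pdivrMr ?subr_gt0//; lra.
- by rewrite subrr mulr0 addr0.
Qed.

(** The half-line []inf J, +oo[] without an infimum in the extended reals; it contains the points
    beyond [J] where [F = 1]. *)
Definition above_J (R : realType) (F : R -> R) : set R :=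
  [set x | exists2 y, J F y & y < x].

Definition transform_concave (R : realType) (s : R) (F : R -> R) : Prop :=
  forall x y t, above_J F x -> above_J F y -> 0 <= t <= 1 ->
    t * power_transform s (F x) + (1 - t) * power_transform s (F y) <=
    power_transform s (F (t * x + (1 - t) * y)).

Lemma open_above_J (R : realType) (F : R -> R) : open (above_J F).
Proof.
rewrite openE => x [y Jy yx]; have := lt_nbhsr yx.
by apply: filterS => z yz; exists y.
Qed.

Lemma above_J_gt0 (R : realType) (F : R -> R) (x : R) :
  {homo F : x y / x <= y} -> above_J F x -> 0 < F x.
Proof.
by move=> Fnd [y /andP[Fy _] yx]; apply: lt_le_trans Fy _; exact/Fnd/ltW.
Qed.

(** Near [x] the increments of the transform of [F] are at most linear: on the right by the
    supergradient [p], on the left by the slope [q] of the chord over [[c, x]]. Those of [F] are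
    smaller still. *)
Lemma transform_concave_continuous (R : realType) (s : R) (F : R -> R) (x : R) :
  s <= 1 -> {homo F : x y / x <= y} -> (forall x, F x <= 1) ->
  transform_concave s F -> above_J F x -> {for x, continuous F}.
Proof.
move=> s1 Fnd F1 FC Jx.
have [p px] := concave_supergradient (@open_above_J _ F) Jx FC.
have [c [d [Jc Jd cx xd]]] := open_itv_nbhs (@open_above_J _ F) Jx.
have F0 y : above_J F y -> 0 < F y by exact: above_J_gt0.
pose U := power_transform s.
pose q := (U (F x) - U (F c)) / (x - c).
pose M := `|p| + `|q|.
have FM y : c < y -> y < d -> `|F y - F x| <= M * `|y - x|.
  move=> cy yd; have Jy : above_J F y.
    by case: Jc => z Jz zc; exists z => //; exact: lt_trans zc cy.
  have [yx|xy] := leP y x.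
    rewrite ler0_norm ?subr_le0 ?Fnd// ler0_norm ?subr_le0//.
    have := power_transform_expand s1 (F0 _ Jy) (Fnd _ _ yx) (F1 x).
    move: yx; rewrite le_eqVlt => /predU1P[->|yx];
      first by rewrite !subrr oppr0 mulr0.
    have := concave_slope FC Jc Jx cy yx.
    rewrite -/U => h1 h2.
    have h3 : (U (F x) - U (F y)) <= q * (x - y).
      rewrite /q mulrAC ler_pdivlMr ?subr_gt0//; lra.
    have : q <= M by rewrite /M ler_wpDl// ler_norm.
    by rewrite -subr_gt0 in yx; move=> /(ler_wpM2r (ltW yx)); lra.
  rewrite ger0_norm ?subr_ge0 ?Fnd ?(ltW xy)// ger0_norm ?subr_ge0 ?(ltW xy)//.
  have := power_transform_expand s1 (F0 _ Jx) (Fnd _ _ (ltW xy)) (F1 y).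
  have := px _ Jy; have : p <= M by rewrite /M ler_wpDr// ler_norm.
  by rewrite -subr_gt0 in xy; move=> /(ler_wpM2r (ltW xy)); lra.
apply/(@cvgrPdist_le R R) => e e0.
have M0 : 0 < M + 1 by rewrite ltr_wpDl// addr_ge0.
have eM : 0 < e / (M + 1) by rewrite divr_gt0.
near=> y; rewrite distrC; apply: le_trans (FM y _ _) _.
- by near: y; exact: lt_nbhsr.
- by near: y; exact: lt_nbhsl.
apply: (@le_trans _ _ ((M + 1) * `|x - y|)).
  by rewrite (distrC x) ler_wpM2r// lerDl.
rewrite mulrC -ler_pdivlMr//; near: y.
Unshelve. all: by end_near.
Qed.

(* A turns the supergradient of the transform of F at x into a differentiable
   majorant of F touching F at x. The same lemma for reflect F yields a
   minorant, and F is squeezed between the two. *)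
Lemma transform_concave_majorant (R : realType) (s : R) (F : R -> R) (x : R) :
  {homo F : x y / x <= y} -> transform_concave s F -> above_J F x ->
  {for x, continuous F} ->
  exists A a, [/\ A x = F x, is_derive x 1 A a,
    \forall y \near x, F y <= A y &
    forall y, above_J F y -> power_transform s (F y) <=
      power_transform s (F x) + a * F x `^ (s - 1) * (y - x)].
Proof.
move=> Fnd FC Jx cF; have Fx0 := above_J_gt0 Fnd Jx.
have [p px] := concave_supergradient (@open_above_J _ F) Jx FC.
have /is_derive1_caratheodory[th [thE cth thx]] :=
  is_derive_power_transform s Fx0.
have thx0 : 0 < th (F x) by rewrite thx powR_gt0.
have cthF : {for x, continuous (th \o F)} by exact: continuous_comp.
have thF0 : \forall y \near x, 0 < th (F y).
  by have := cthF _ (lt_nbhsr thx0).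
(* The supergradient inequality reads [th (F y) * (F y - F x) <= p * (y - x)]. Dividing by
   [th (F y)] gives a majorant whose Caratheodory slope [p / th (F y)] is continuous at [x] as soon
   as [F] is. *)
exists (fun y => F x + p / th (F y) * (y - x)), (p / th (F x)); split.
- by rewrite subrr mulr0 addr0.
- apply/is_derive1_caratheodory; exists (fun y => p / th (F y)); split => //.
    by move=> z; rewrite subrr mulr0 addr0 addrAC subrr add0r.
  apply: continuousM; first exact: cvg_cst.
  by apply: continuousV; first exact: lt0r_neq0.
- have Jnear := open_nbhs_nbhs (conj (@open_above_J _ F) Jx).
  apply: filterS2 thF0 Jnear => y thy Jy.
  rewrite -lerBlDl mulrAC ler_pdivlMr// mulrC -thE lerBlDl.
  exact: px.
- move=> y Jy; rewrite -thx divfK ?gt_eqF//; exact: px.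
Qed.

(** * Reflection of a distribution function *)

(** If [F] is continuous and is the distribution function of [X], this is the distribution function
    of [-X]. *)
Definition reflect (R : realType) (F : R -> R) (x : R) : R := 1 - F (- x).

Lemma reflectK (R : realType) (F : R -> R) : reflect (reflect F) = F.
Proof. by apply/funext => x; rewrite /reflect opprK subKr. Qed.

Lemma J_reflect (R : realType) (F : R -> R) (x : R) :
  J (reflect F) x <-> J F (- x).
Proof. by rewrite /J/reflect/=; split=> /andP[? ?]; apply/andP; split; lra. Qed.

Lemma is_derive_reflect (R : realType) (F : R -> R) (x a : R) :
  is_derive x 1 (reflect F) a <-> is_derive (- x) 1 F a.
Proof.
suff h (G : R -> R) (y : R) : is_derive (- y) 1 G a ->
  is_derive y 1 (reflect G) a.
  split; last exact: h.
  by rewrite -[x in is_derive x _ _ _ -> _]opprK => /h; rewrite reflectK.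
move=> /is_derive1_caratheodory[g [gE cg gy]].
apply/is_derive1_caratheodory; exists (g \o -%R); split => //=.
  by move=> z; rewrite /reflect; have := gE (- z); lra.
by apply: continuous_comp => //; exact: continuousN.
Qed.

Lemma continuous_reflect (R : realType) (F : R -> R) (x : R) :
  {for x, continuous (reflect F)} <-> {for - x, continuous F}.
Proof.
suff h (G : R -> R) (y : R) : {for - y, continuous G} ->
  {for y, continuous (reflect G)}.
  split; last exact: h.
  by rewrite -[x in {for x, _} -> _]opprK => /h; rewrite reflectK.
move=> cG; apply: continuousB; first exact: cvg_cst.
by apply: continuous_comp; first exact: continuousN.
Qed.

Lemma nondecreasing_reflect (R : realType) (F : R -> R) :
  {homo F : x y / x <= y} -> {homo reflect F : x y / x <= y}.
Proof.
by move=> Fnd x y xy; rewrite lerD2l lerN2; apply: Fnd; rewrite lerN2.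
Qed.

(** Right-continuity is left out, since reflection turns it into left-continuity. *)
Definition cdf (R : realType) (F : R -> R) : Prop :=
  [/\ {homo F : x y / x <= y}, (forall x, 0 <= F x <= 1),
      (forall e, 0 < e -> exists x, F x < e) &
      (forall e, 0 < e -> exists x, 1 - e < F x)].

Lemma cdf_reflect (R : realType) (F : R -> R) : cdf F -> cdf (reflect F).
Proof.
move=> [Fnd F01 F0 F1]; split.
- exact: nondecreasing_reflect.
- by move=> x; rewrite /reflect; have := F01 (- x); lra.
- move=> e /F1[x Fx]; exists (- x); rewrite /reflect opprK; lra.
- move=> e /F0[x Fx]; exists (- x); rewrite /reflect opprK; lra.
Qed.

Lemma open_J (R : realType) (F : R -> R) : continuous F -> open (J F).
Proof.
move=> cF; have -> : J F = F @^-1` `]0, 1[%classic.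
  by apply/seteqP; split => x; rewrite /J/= in_itv.
by move/continuousP : cF; apply; exact: interval_open.
Qed.

Lemma J_above (R : realType) (F : R -> R) (x : R) :
  continuous F -> J F x -> above_J F x.
Proof.
move=> /open_J oJ Jx; have [c [_ [Jc _ cx _]]] := open_itv_nbhs oJ Jx.
by exists c.
Qed.

(** The first inequality of (ii) in a form common to all [s]: [f x * F x^(s-1)] is the derivative at
    [x] of the transform of [F]. *)
Definition tangent_bound (R : realType) (s : R) (F f : R -> R) : Prop :=
  forall x y, J F x -> J F y -> power_transform s (F y) <=
    power_transform s (F x) + f x * F x `^ (s - 1) * (y - x).

(** Two points [m < n] of [J F] make the two concavity domains cover the line: [x > m] lies above
    [m], and for [x <= m] the point [- x] lies above [- n]. Continuity follows everywhere, then
    differentiability by squeezing. *)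
Lemma transform_concave_tangent (R : realType) (s : R) (F : R -> R) (m n : R) :
  s <= 1 -> cdf F -> J F m -> J F n -> m < n ->
  transform_concave s F -> transform_concave s (reflect F) ->
  continuous F /\ exists f : R -> R, [/\
    forall x, J F x -> is_derive x 1 F (f x),
    tangent_bound s F f & tangent_bound s (reflect F) (f \o -%R)].
Proof.
move=> s1 cdfF Jm Jn mn FC GC.
have [Fnd F01 _ _] := cdfF; have [Gnd G01 _ _] := cdf_reflect cdfF.
have cF : continuous F.
  move=> x; have [xm|mx] := leP x m.
    rewrite -[x]opprK; apply/continuous_reflect.
    apply: transform_concave_continuous GC _ => //.
      by move=> y; have /andP[] := G01 y.
    by exists (- n); rewrite ?ltrN2 ?(le_lt_trans xm mn)//; apply/J_reflect;
      rewrite opprK.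
  apply: transform_concave_continuous FC _ => //; last by exists m.
  by move=> y; have /andP[] := F01 y.
have cG : continuous (reflect F).
  by move=> x; apply/continuous_reflect; exact: cF.
split=> //.
have /choice[f fP] : forall x, exists a : R, J F x -> [/\ is_derive x 1 F a,
    forall y, J F y -> power_transform s (F y) <=
      power_transform s (F x) + a * F x `^ (s - 1) * (y - x) &
    forall y, J F y -> power_transform s (reflect F (- y)) <=
      power_transform s (reflect F (- x)) +
      a * reflect F (- x) `^ (s - 1) * (- y - - x)].
  move=> x; have [Jx|nJx] := pselect (J F x); last by exists 0.
  have JGN y : J F y -> above_J (reflect F) (- y).
    by move=> Jy; apply: J_above => //; apply/J_reflect; rewrite opprK.
  have [A [a [Ax dA FA Fa]]] :=
    transform_concave_majorant Fnd FC (J_above cF Jx) (cF x).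
  have [B [b [Bx dB GB Gb]]] :=
    transform_concave_majorant Gnd GC (JGN _ Jx) (cG (- x)).
  (* [F] lies between [reflect B] and [A], which both touch it at [x]; so the two supergradients
     come from the same number [a = b]. *)
  have [||||ba dF] := @squeeze_derive _ (reflect B) F A x b a.
  - have : \forall y \near x, reflect F (- y) <= B (- y).
      have cN : {for x, continuous (-%R : R -> R)} by exact: opp_continuous.
      exact: cN _ GB.
    apply: filterS2 FA => y FAy; rewrite /reflect opprK => GBy.
    by rewrite FAy andbT; lra.
  - by rewrite /reflect Bx /reflect opprK; lra.
  - exact: Ax.
  - exact/is_derive_reflect.
  exists b => _; split => //; first by move=> y Jy;
    rewrite ba; exact/Fa/J_above.
  by move=> y Jy; apply/Gb/JGN.
exists f; split.
- by move=> x /fP[].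
- by move=> x y /fP[_ Fx _] Jy; exact: Fx.
- move=> x y /J_reflect/fP[_ _ Gx] /J_reflect /Gx; rewrite !opprK.
  exact.
Qed.

(* One half of the bounds of bi-s-concavity, with u = F x, v = F y and
   k = f x * (y - x). *)
Definition half_bound (R : realType) (s u v k : R) : Prop :=
  if s == 0 then v <= u * expR (k / u)
  else (v%:E <= u%:E * epow (pospart (1 + s * (k / u))) s^-1)%E.

(** The power transform is strictly increasing on positive reals and may be applied to both
    sides. *)
Lemma half_boundE (R : realType) (s u v k : R) : 0 < u -> 0 < v ->
  half_bound s u v k <->
  power_transform s v <= power_transform s u + k * u `^ (s - 1).
Proof.
move=> u0 v0; rewrite /half_bound /power_transform.
have [->|s0] := eqVneq s 0.
  rewrite sub0r powR_inv1; last exact: ltW.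
  by rewrite -[_ <= ln u + _]ler_expR expRD !lnK ?posrE.
have us0 : 0 < u `^ s by exact: powR_gt0.
have -> : u `^ s / s + k * u `^ (s - 1) = u `^ s * (1 + s * (k / u)) / s.
  rewrite powRB; last by rewrite (gt_eqF u0) implybT.
  rewrite powRr1 ?ltW//; field; rewrite s0 gt_eqF//.
set w := 1 + s * (k / u); rewrite /epow /pospart.
have vs0 : 0 < v `^ s by exact: powR_gt0.
(* If the positive part vanishes, both sides of the equivalence hold for [s < 0], where the bound is
   [+oo], and both fail for [s > 0], where it is 0. *)
have [w0|w0] := leP w 0.
  rewrite eqxx/= invr_lt0.
  have [slt0|sgt0] := ltP s 0.
    rewrite mulry gtr0_sg// mul1e leey; split=> // _.
    apply: (@le_trans _ _ 0).
      by rewrite pmulr_rle0// invr_le0 ltW.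
    by rewrite mulr_le0// ?invr_le0 ?(ltW slt0)// pmulr_rle0.
  rewrite powR0 ?invr_eq0// mule0 lee_fin leNgt v0/=; split=> //.
  have {}sgt0 : 0 < s by rewrite lt_neqAle eq_sym s0.
  rewrite ler_pM2r ?invr_gt0// => /(lt_le_trans vs0).
  by rewrite pmulr_rgt0// ltNge w0.
rewrite (gt_eqF w0)/= -EFinM lee_fin.
have z0 : 0 < u * w `^ s^-1 by rewrite mulr_gt0// powR_gt0.
have -> : u `^ s * w = (u * w `^ s^-1) `^ s.
  by rewrite powRM ?powR_ge0 ?ltW// -powRrM mulVf// powRr1// ltW.
have Uv := power_transform_lt s z0 (v := v).
have Uz := power_transform_le s v0 (v := u * w `^ s^-1).
move: Uv Uz; rewrite /power_transform (negbTE s0) => Uv Uz.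
by split=> //; case: (leP v (u * w `^ s^-1)) => // /Uv; rewrite ltNge => /negP.
Qed.

(** * Bi-concavity as concavity of power transforms *)

Lemma ereal_inf_J_lt (R : realType) (F : R -> R) (x : R) :
  (ereal_inf (EFin @` J F) < x%:E)%E <-> above_J F x.
Proof.
split=> [/ereal_inf_lt[_ [y Jy <-]]|[y Jy yx]].
  by rewrite lte_fin => yx; exists y.
apply: le_lt_trans (_ : (y%:E < _)%E); last by rewrite lte_fin.
by apply: ereal_inf_lbound; exists y.
Qed.

Lemma ereal_sup_J_gt (R : realType) (F : R -> R) (x : R) :
  (x%:E < ereal_sup (EFin @` J F))%E <-> above_J (reflect F) (- x).
Proof.
split=> [/ereal_sup_gt[_ [y Jy <-]]|[y /J_reflect Jy yx]].
  rewrite lte_fin => xy; exists (- y); last by rewrite ltrN2.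
  by apply/J_reflect; rewrite opprK.
apply: (@lt_le_trans _ _ (- y)%:E); first by rewrite lte_fin ltrNr.
by apply: ereal_sup_ubound; exists (- y).
Qed.

Lemma concave_onP (R : realType) (D : set R) (f : R -> R) :
  concave_on D f <-> forall x y t, D x -> D y -> 0 <= t <= 1 ->
    t * f x + (1 - t) * f y <= f (t * x + (1 - t) * y).
Proof.
split=> [fD x y t Dx Dy t01|fD t x y /set_mem Dx /set_mem Dy].
  pose k : {i01 R} := Itv01 (proj1 (andP t01)) (proj2 (andP t01)).
  have : - f (t * x + (1 - t) * y) <= t * - f x + (1 - t) * - f y.
    exact: fD k x y (mem_set Dx) (mem_set Dy).
  by lra.
have fxy : - f (t%:num * x + (1 - t%:num) * y) <=
    t%:num * - f x + (1 - t%:num) * - f y.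
  have := fD x y t%:num Dx Dy; rewrite ge0 le1 => /(_ isT).
  by lra.
exact: fxy.
Qed.

Definition half_bi_concave (R : realType) (s : R) (F : R -> R) : Prop :=
  if s < 0 then econvex (fun x => epow (F x) s)
  else if s == 0 then econcave (fun x => lne (F x)%:E)
  else concave_on (above_J F) (fun x => F x `^ s).

Lemma econvex_opp (R : realType) (g h : R -> \bar R) :
  (forall x, h x = g (- x)) -> econvex g -> econvex h.
Proof.
move=> hg gc x y t t01; rewrite !hg opprD -!mulrN; exact: gc.
Qed.

Lemma econcave_opp (R : realType) (g h : R -> \bar R) :
  (forall x, h x = g (- x)) -> econcave g -> econcave h.
Proof.
move=> hg gc x y t t01; rewrite !hg opprD -!mulrN; exact: gc.
Qed.

Lemma bi_concaveE (R : realType) (s : R) (F : R -> R) :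
  bi_concave s F <-> half_bi_concave s F /\ half_bi_concave s (reflect F).
Proof.
rewrite /bi_concave /half_bi_concave; case: ifP => [_|_].
  by split=> -[F1 F2]; split=> //; apply: econvex_opp F2 => x;
    rewrite /reflect ?opprK.
case: ifP => [_|_].
  by split=> -[F1 F2]; split=> //; apply: econcave_opp F2 => x;
    rewrite /reflect ?opprK.
have -> : [set x | (ereal_inf (EFin @` J F) < x%:E)%E] = above_J F.
  by apply/seteqP; split => x /ereal_inf_J_lt.
split=> -[F1 /concave_onP F2]; split=> //; apply/concave_onP => x y t Jx Jy t01.
  have := F2 (- x) (- y) t _ _ t01.
  rewrite /reflect opprD -!mulrN /=; apply; apply/ereal_sup_J_gt;
    rewrite opprK//.
have := F2 (- x) (- y) t _ _ t01.
rewrite /reflect !opprK !mulrN -opprD !opprK; apply.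
  exact/ereal_sup_J_gt.
exact/ereal_sup_J_gt.
Qed.

Lemma epow_gt0 (R : realType) (u s : R) : 0 < u -> epow u s = (u `^ s)%:E.
Proof. by move=> u0; rewrite /epow gt_eqF. Qed.

Lemma above_J_conv (R : realType) (F : R -> R) (x y t : R) : 0 <= t <= 1 ->
  above_J F x -> above_J F y -> above_J F (t * x + (1 - t) * y).
Proof.
move=> /andP[t0 t1] [x' Jx' x'x] [y' Jy' y'y].
have [xy|/ltW yx] := leP x y.
  by exists x' => //; apply: lt_le_trans x'x _; nra.
by exists y' => //; apply: lt_le_trans y'y _; nra.
Qed.

(** On the half-line [F] is positive, so all values are finite; for [s < 0], division by [s] turns
    convexity into concavity. *)
Lemma half_transform_concave (R : realType) (s : R) (F : R -> R) :
  {homo F : x y / x <= y} -> half_bi_concave s F -> transform_concave s F.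
Proof.
move=> Fnd; rewrite /half_bi_concave /transform_concave /power_transform => FC.
move=> x y t Jx Jy t01; have Jz := above_J_conv t01 Jx Jy.
have [Fx Fy] := (above_J_gt0 Fnd Jx, above_J_gt0 Fnd Jy).
have Fz := above_J_gt0 Fnd Jz; move: FC.
have [s0 FC|] := ltP s 0.
  have := FC x y t t01; rewrite !epow_gt0// -!EFinM -EFinD lee_fin => h.
  by rewrite (lt_eqF s0) !mulrA -mulrDl ler_nM2r ?invr_lt0.
rewrite le_eqVlt eq_sym => /orP[/eqP-> FC|s0].
  by rewrite eqxx in FC *; have := FC x y t t01; rewrite !lne_EFin.
rewrite gt_eqF// => /concave_onP FC; have := FC x y t Jx Jy t01.
by rewrite !mulrA -mulrDl ler_pM2r ?invr_gt0.
Qed.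

(** By the intermediate value theorem [F] takes the value [F x / 2], at a point of [J F] to the left
    of [x]. *)
Lemma gt0_above_J (R : realType) (F : R -> R) (x : R) :
  cdf F -> continuous F -> 0 < F x -> above_J F x.
Proof.
move=> [Fnd F01 F0 _] cF Fx; have e0 : 0 < F x / 2 by rewrite divr_gt0.
have [w Fw] := F0 _ e0; have /andP[_ Fx1] := F01 x.
have wx : w < x by rewrite ltNge; apply/negP => /Fnd; lra.
have [||y] := @IVT _ F w x (F x / 2) (ltW wx).
- exact: continuous_subspaceT.
- by rewrite min_l ?max_r ?Fnd ?ltW//; lra.
rewrite in_itv/= => /andP[_ yx] Fy; exists y.
  by rewrite /J/= Fy; apply/andP; split; lra.
by rewrite lt_neqAle yx andbT; apply/eqP => yx'; rewrite yx' in Fy; lra.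
Qed.

(** By continuity [F] vanishes wherever [above_J F] fails. For [s <= 0] such a point contributes an
    infinite term that makes the inequality trivial, unless its weight is 0; hence [t = 0] and
    [t = 1] are treated first. *)
Lemma transform_concave_half (R : realType) (s : R) (F : R -> R) :
  cdf F -> continuous F -> transform_concave s F -> half_bi_concave s F.
Proof.
move=> cdfF cF; rewrite /half_bi_concave /transform_concave /power_transform.
have [Fnd F01 _ _] := cdfF => FC.
have JP x : F x = 0 \/ above_J F x.
  have /andP[+ _] := F01 x; rewrite le_eqVlt => /predU1P[->|]; first by left.
  by move=> /(gt0_above_J cdfF cF); right.
have [s0|] := ltP s 0.
  rewrite (lt_eqF s0) in FC.
  have g0 x : (0 <= epow (F x) s)%E.
    by rewrite /epow; case: ifP => // _; rewrite lee_fin powR_ge0.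
  move=> x y t t01; have [->|t0] := eqVneq t 0.
    by rewrite mul0e mul0r !add0r subr0 mul1e mul1r.
  have [->|t1] := eqVneq t 1.
    by rewrite subrr mul0e mul0r !addr0 mul1e mul1r.
  have {}t0 : 0 < t by case/andP: t01; rewrite le_eqVlt eq_sym (negbTE t0).
  have {}t1 : 0 < 1 - t by rewrite subr_gt0 lt_neqAle t1; case/andP: t01.
  case: (JP x) => [Fx|Jx].
    rewrite {2}/epow Fx eqxx s0 mulry gtr0_sg// mul1e addye ?leey//.
    by rewrite gt_eqF// (lt_le_trans (ltNyr 0))// mule_ge0// lee_fin ltW.
  case: (JP y) => [Fy|Jy].
    rewrite {3}/epow Fy eqxx s0 mulry gtr0_sg// mul1e addey ?leey//.
    by rewrite gt_eqF// (lt_le_trans (ltNyr 0))// mule_ge0// lee_fin ltW.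
  have Jz := above_J_conv t01 Jx Jy.
  have [Fx Fy] := (above_J_gt0 Fnd Jx, above_J_gt0 Fnd Jy).
  have Fz := above_J_gt0 Fnd Jz.
  rewrite !epow_gt0// -!EFinM -EFinD lee_fin.
  by have := FC x y t Jx Jy t01; rewrite !mulrA -mulrDl ler_nM2r ?invr_lt0.
rewrite le_eqVlt eq_sym => /orP[/eqP s0|s0].
  rewrite s0 eqxx in FC *.
  have g0 x : (lne (F x)%:E <= 0)%E.
    by rewrite lne_le0 lee_fin; case/andP: (F01 x).
  move=> x y t t01; have [->|t0] := eqVneq t 0.
    by rewrite mul0e mul0r !add0r subr0 mul1e mul1r.
  have [->|t1] := eqVneq t 1.
    by rewrite subrr mul0e mul0r !addr0 mul1e mul1r.
  have {}t0 : 0 < t by case/andP: t01; rewrite le_eqVlt eq_sym (negbTE t0).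
  have {}t1 : 0 < 1 - t by rewrite subr_gt0 lt_neqAle t1; case/andP: t01.
  case: (JP x) => [Fx|Jx].
    rewrite (@le0_lneNy _ (F x)%:E) ?Fx//.
    by rewrite mulrNy gtr0_sg// mul1e addNye// leNye.
  case: (JP y) => [Fy|Jy].
    rewrite (@le0_lneNy _ (F y)%:E) ?Fy//.
    by rewrite mulrNy gtr0_sg// mul1e addeNy// leNye.
  have Jz := above_J_conv t01 Jx Jy.
  have [Fx Fy] := (above_J_gt0 Fnd Jx, above_J_gt0 Fnd Jy).
  have Fz := above_J_gt0 Fnd Jz.
  by rewrite !lne_EFin// -!EFinM -EFinD lee_fin; exact: FC.
rewrite (gt_eqF s0) in FC *; apply/concave_onP => x y t Jx Jy t01.
by have := FC x y t Jx Jy t01; rewrite !mulrA -mulrDl ler_pM2r ?invr_gt0.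
Qed.

(** * Hazard functions *)

Lemma rev_hazardE (R : realType) (s : R) (F f : R -> R) (x : R) :
  rev_hazard s F f x = f x * F x `^ (s - 1).
Proof. by rewrite /rev_hazard -powRN opprB. Qed.

Lemma hazardE (R : realType) (s : R) (F f : R -> R) (x : R) :
  hazard s F f x = rev_hazard s (reflect F) (f \o -%R) (- x).
Proof. by rewrite /hazard /rev_hazard /reflect /= opprK. Qed.

Definition rev_hazard_nonincreasing (R : realType) (s : R) (F f : R -> R) :=
  forall x y, J F x -> J F y -> x <= y ->
    rev_hazard s F f y <= rev_hazard s F f x.

Lemma tangent_bound_nonincreasing (R : realType) (s : R) (F f : R -> R) :
  tangent_bound s F f -> rev_hazard_nonincreasing s F f.
Proof.
move=> FT x y Jx Jy; rewrite le_eqVlt => /predU1P[->//|xy].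
have := FT x y Jx Jy; have := FT y x Jy Jx; rewrite -!rev_hazardE => h1 h2.
rewrite -subr_ge0 -(@pmulr_rge0 _ (y - x)) ?subr_gt0//; lra.
Qed.

Lemma is_derive_nondecreasing_ge0 (R : realType) (g : R -> R) (x a : R) :
  (\forall y \near x, x < y -> g x <= g y) -> is_derive x 1 g a -> 0 <= a.
Proof.
move=> gnd /is_derive1P ga; apply/ler_addgt0Pr => e e0.
have [y xy [/(_ xy) gxy h]] := near_gt_exists (filterI gnd (ga e e0)).
move: h; rewrite (gtr0_norm (_ : 0 < y - x)) ?subr_gt0// ler_norml =>
  /andP[_ h].
by rewrite -(@pmulr_rge0 _ (y - x)) ?subr_gt0//; lra.
Qed.

Lemma derive_ge0 (R : realType) (F f : R -> R) :
  {homo F : x y / x <= y} -> (forall x, J F x -> is_derive x 1 F (f x)) ->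
  forall x, J F x -> 0 <= f x.
Proof.
move=> Fnd dF x Jx; apply: is_derive_nondecreasing_ge0 (dF x Jx).
exact: (@filterE _ (nbhs x) _ _ (fun y xy => Fnd _ _ (ltW xy))).
Qed.

Lemma is_derive_continuous (R : realType) (g : R -> R) (x a : R) :
  is_derive x 1 g a -> {for x, continuous g}.
Proof.
by move=> /@ex_derive dg; apply: differentiable_continuous;
  exact/derivable1_diffP.
Qed.

Lemma J_itv (R : realType) (F : R -> R) (x y z : R) :
  {homo F : x y / x <= y} -> J F x -> J F y -> x <= z <= y -> J F z.
Proof.
move=> Fnd /andP[Fx _] /andP[_ Fy] /andP[/Fnd xz /Fnd zy].
by apply/andP; split; lra.
Qed.

Lemma J_MVT (R : realType) (F g dg : R -> R) (x y : R) :
  {homo F : x y / x <= y} -> (forall x, J F x -> is_derive x 1 g (dg x)) ->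
  J F x -> J F y -> x < y ->
  exists c, [/\ J F c, x < c, c < y & g y - g x = dg c * (y - x)].
Proof.
move=> Fnd dF Jx Jy xy.
have Jz z : x <= z <= y -> J F z by exact: J_itv.
have [||c] := @MVT _ g dg x y xy.
- move=> z; rewrite in_itv/= => /andP[xz zy]; apply/dF/Jz.
  by rewrite !ltW.
- apply: continuous_in_subspaceT => z; rewrite inE/= in_itv/= => xzy.
  exact: is_derive_continuous (dF _ (Jz _ xzy)).
rewrite in_itv/= => /andP[xc cy] E; exists c; split => //.
by apply: Jz; rewrite !ltW.
Qed.

(** [rev_hazard s F f] is the derivative of the transform of [F], so the mean value theorem compares
    the chord from [x] to [y] with the tangent at [x]. *)
Lemma nonincreasing_tangent (R : realType) (s : R) (F f : R -> R) :
  {homo F : x y / x <= y} -> (forall x, J F x -> is_derive x 1 F (f x)) ->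
  rev_hazard_nonincreasing s F f -> tangent_bound s F f.
Proof.
move=> Fnd dF rF x y Jx Jy; rewrite -rev_hazardE.
have dUF z : J F z ->
    is_derive z 1 (power_transform s \o F) (rev_hazard s F f z).
  move=> Jz; rewrite rev_hazardE mulrC; apply: is_derive1_comp; last exact: dF.
  by apply: is_derive_power_transform; case/andP: Jz.
have [xy|yx|->] := ltrgtP x y; last by rewrite subrr mulr0 addr0.
  have [c [Jc xc _ /= E]] := J_MVT Fnd dUF Jx Jy xy.
  rewrite -lerBlDl E ler_wpM2r ?subr_ge0 ?(ltW xy)//.
  by apply: rF => //; exact: ltW.
have [c [Jc _ cx /= E]] := J_MVT Fnd dUF Jy Jx yx.
have : rev_hazard s F f x * (x - y) <= rev_hazard s F f c * (x - y).
  by rewrite ler_wpM2r ?subr_ge0 ?(ltW yx)//; apply: rF => //; exact: ltW.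
by lra.
Qed.

Lemma not_J_eq1 (R : realType) (F : R -> R) (x : R) :
  cdf F -> above_J F x -> ~ J F x -> F x = 1.
Proof.
move=> [Fnd F01 _ _] /(above_J_gt0 Fnd) Fx nJ; have /andP[_ Fx1] := F01 x.
apply/eqP; rewrite eq_le Fx1 leNgt; apply/negP => Fx1'; apply: nJ.
by apply/andP.
Qed.

(** At a combination lying in [J F], the tangent inequalities at that point are averaged. At a
    combination where [F = 1] the transform is maximal. *)
Lemma tangent_transform_concave (R : realType) (s : R) (F f : R -> R) :
  cdf F -> continuous F -> (forall x, J F x -> 0 <= f x) ->
  tangent_bound s F f -> transform_concave s F.
Proof.
move=> cdfF cF f0 FT; have [Fnd F01 _ _] := cdfF.
(* The tangent bound is extended to points [y] with [F y = 1]. If it failed there, it would fail at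
   some [z] between [x] and [y] with [F z < 1] close to 1, the slope being nonnegative. *)
have tgt x y : J F x -> above_J F y -> power_transform s (F y) <=
    power_transform s (F x) + rev_hazard s F f x * (y - x).
  move=> Jx Jy; have [Jy'|nJy] := pselect (J F y).
    by rewrite rev_hazardE; exact: FT.
  have Fy := not_J_eq1 cdfF Jy nJy; rewrite Fy leNgt; apply/negP => hlt.
  have /andP[Fx0 Fx1] := Jx.
  have xy : x < y by rewrite ltNge; apply/negP => /Fnd; lra.
  have cU : {for 1, continuous (power_transform s)}.
    exact: is_derive_continuous (is_derive_power_transform s ltr01).
  have hU : \forall v \near (1 : R), power_transform s (F x) +
      rev_hazard s F f x * (y - x) < power_transform s v.
    exact: cU _ (lt_nbhsr hlt).
  have [v v1 [/= hv xv]] := near_lt_exists (filterI hU (lt_nbhsr Fx1)).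
  have [||z] := @IVT _ F x y v (ltW xy).
  - exact: continuous_subspaceT.
  - by rewrite Fy min_l ?max_r ?(ltW Fx1)// !ltW.
  rewrite in_itv/= => /andP[xz zy] Fz.
  have Jz : J F z by rewrite /J/= Fz v1 (lt_trans Fx0 xv).
  have := FT x z Jx Jz; rewrite -rev_hazardE Fz leNgt => /negP; apply.
  apply: le_lt_trans hv; rewrite lerD2l ler_wpM2l ?lerD2r// rev_hazardE.
  by rewrite mulr_ge0 ?powR_ge0// f0.
move=> x y t Jx Jy t01; have Jz := above_J_conv t01 Jx Jy.
have [t0 t1] : 0 <= t /\ 0 <= 1 - t by rewrite subr_ge0; apply/andP.
set z := t * x + _ in Jz *; have [Jz'|nJz] := pselect (J F z).
  have := ler_wpM2l t0 (tgt z x Jz' Jx); have := ler_wpM2l t1 (tgt z y Jz' Jy).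
  set r := rev_hazard _ _ _ _; rewrite -subr_ge0 => h1; rewrite -subr_ge0 => h2.
  rewrite -subr_ge0; have := addr_ge0 h1 h2; congr (_ <= _); rewrite /z; ring.
rewrite (not_J_eq1 cdfF Jz nJz).
have U1 w : above_J F w -> power_transform s (F w) <= power_transform s 1.
  move=> Jw; apply: power_transform_le; first exact: above_J_gt0.
  by have /andP[] := F01 w.
have := ler_wpM2l t0 (U1 x Jx); have := ler_wpM2l t1 (U1 y Jy); lra.
Qed.

Lemma cdf_surj (R : realType) (F : R -> R) (v : R) :
  cdf F -> continuous F -> 0 < v < 1 -> exists x, F x = v.
Proof.
move=> [Fnd F01 F0 F1] cF /andP[v0 v1]; have [x Fx] := F0 _ v0.
have [y Fy] : exists y, 1 - (1 - v) < F y by apply: F1; rewrite subr_gt0.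
rewrite subKr in Fy.
have xy : x <= y by rewrite leNgt; apply/negP => /ltW/Fnd; lra.
have [||z _ Fz] := @IVT _ F x y v xy.
- exact: continuous_subspaceT.
- by rewrite min_l ?max_r ?Fnd// !ltW.
- by exists z.
Qed.

(** A zero of [f] spreads to the right through [F] and to the left through [reflect F]. Then [F] is
    constant on [J F], whereas it takes the value [(F x + 1) / 2] there. *)
Lemma rev_hazard_nonincreasing_pos (R : realType) (s : R) (F f : R -> R) :
  cdf F -> continuous F -> (forall x, J F x -> is_derive x 1 F (f x)) ->
  rev_hazard_nonincreasing s F f ->
  rev_hazard_nonincreasing s (reflect F) (f \o -%R) ->
  forall x, J F x -> 0 < f x.
Proof.
move=> cdfF cF dF rF rG x Jx; have [Fnd _ _ _] := cdfF.
have f0 := derive_ge0 Fnd dF; rewrite lt_neqAle f0// andbT eq_sym.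
apply/eqP => fx0.
have rE y : J F y -> (rev_hazard s F f y <= 0) = (f y <= 0).
  by move=> /andP[Fy _]; rewrite rev_hazardE pmulr_lle0// powR_gt0.
have fx y : J F y -> f y = 0.
  move=> Jy; apply/eqP; rewrite eq_le f0// andbT; have [xy|/ltW yx] := leP x y.
    by rewrite -rE//; apply: le_trans (rF x y Jx Jy xy) _; rewrite rE// fx0.
  have JN z : J F z -> J (reflect F) (- z).
    by move=> Jz; apply/J_reflect; rewrite opprK.
  have /= := rG (- x) (- y) (JN _ Jx) (JN _ Jy); rewrite lerN2 => /(_ yx).
  rewrite !rev_hazardE /= !opprK fx0 mul0r pmulr_lle0// powR_gt0//.
  by have /andP[] := JN _ Jy.
have /andP[Fx0 Fx1] := Jx.
have [|y Fy] := @cdf_surj _ F ((F x + 1) / 2) cdfF cF; first lra.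
have Jy : J F y by rewrite /J/= Fy; lra.
have xy : x < y by rewrite ltNge; apply/negP => /Fnd; rewrite Fy; lra.
have [c [Jc _ _]] := J_MVT Fnd dF Jx Jy xy.
by rewrite fx// mul0r Fy; lra.
Qed.

Lemma rev_hazard_ge0 (R : realType) (s : R) (F f : R -> R) (x : R) :
  0 <= f x -> 0 <= rev_hazard s F f x.
Proof. by move=> fx; rewrite rev_hazardE mulr_ge0// powR_ge0. Qed.

Lemma powR_le1 (R : realType) (u a : R) : 0 < u <= 1 -> 0 <= a -> u `^ a <= 1.
Proof.
by move=> u01 a0; rewrite -[leRHS](powRr0 u); exact: ger_powR.
Qed.

Lemma rev_hazardK (R : realType) (s : R) (F f : R -> R) (x : R) :
  0 < F x -> f x = rev_hazard s F f x * F x `^ (1 - s).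
Proof. by move=> Fx; rewrite /rev_hazard divfK// gt_eqF// powR_gt0. Qed.

Lemma rev_hazard_bound (R : realType) (s : R) (F f : R -> R) (x y : R) :
  s <= 1 -> (forall x, J F x -> 0 <= f x) -> rev_hazard_nonincreasing s F f ->
  J F x -> J F y -> x <= y -> f y <= rev_hazard s F f x.
Proof.
move=> s1 f0 rF Jx Jy xy; have /andP[Fy0 Fy1] := Jy.
rewrite (@rev_hazardK _ s F)//; apply: le_trans (rF x y Jx Jy xy).
rewrite ler_piMr//; first exact/rev_hazard_ge0/f0.
by rewrite powR_le1 ?subr_ge0// Fy0 ltW.
Qed.

(** To the right of [m] the reverse hazard at [m] bounds [f], because [F^(1-s) <= 1]; to the left
    the reflected one does. Both are nonnegative, so their sum is a common bound. *)
Lemma rev_hazard_nonincreasing_bounded (R : realType) (s : R) (F f : R -> R) :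
  s <= 1 -> (forall x, J F x -> 0 <= f x) ->
  rev_hazard_nonincreasing s F f ->
  rev_hazard_nonincreasing s (reflect F) (f \o -%R) ->
  exists M, forall x, J F x -> f x <= M.
Proof.
move=> s1 f0 rF rG; have [[m Jm]|noJ] := pselect (exists m, J F m); last first.
  by exists 0 => x Jx; exfalso; apply: noJ; exists x.
exists (rev_hazard s F f m + rev_hazard s (reflect F) (f \o -%R) (- m)) => x Jx.
have JN z : J F z -> J (reflect F) (- z).
  by move=> Jz; apply/J_reflect; rewrite opprK.
have g0 z : J (reflect F) z -> 0 <= (f \o -%R) z by move=> /J_reflect/f0.
have [mx|/ltW xm] := leP m x.
  apply: le_trans (rev_hazard_bound s1 f0 rF Jm Jx mx) _.
  by rewrite lerDl; exact/rev_hazard_ge0/g0/JN.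
have := rev_hazard_bound s1 g0 rG (JN _ Jm) (JN _ Jx).
rewrite lerN2 => /(_ xm) /=; rewrite opprK => /le_trans; apply.
by rewrite lerDr; exact/rev_hazard_ge0/f0.
Qed.

(** Since [f] is the reverse hazard times [F^(1-s)] and the first factor decreases, only the growth
    of [F^(1-s)] matters. This is the upper half of the Lipschitz estimate; the reflection gives the
    lower half. *)
Lemma rev_hazard_nonincreasing_lipschitz (R : realType) (s M : R)
    (F f : R -> R) (c : R) :
  s <= 1 -> {homo F : x y / x <= y} ->
  (forall x, J F x -> is_derive x 1 F (f x)) ->
  (forall x, J F x -> f x <= M) -> rev_hazard_nonincreasing s F f -> J F c ->
  exists2 K, 0 <= K & forall x y, J F x -> J F y -> c <= x -> x <= y ->
    f y - f x <= K * (y - x).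
Proof.
move=> s1 Fnd dF fM rF Jc; have f0 := derive_ge0 Fnd dF.
have M0 : 0 <= M by exact: le_trans (f0 c Jc) (fM c Jc).
have rc0 : 0 <= rev_hazard s F f c by exact/rev_hazard_ge0/f0.
(* Bounds [F^(-s)] to the right of [c] for either sign of [s]: by 1 if [s < 0], by [F c^(-s)] if
   [s >= 0]. *)
pose N := 1 + F c `^ (- s).
have N0 : 0 <= N by rewrite addr_ge0// powR_ge0.
have s10 : 0 <= 1 - s by rewrite subr_ge0.
exists (rev_hazard s F f c * ((1 - s) * N * M)).
  by apply: mulr_ge0 => //; apply: mulr_ge0 => //; exact: mulr_ge0.
move=> x y Jx Jy cx; rewrite le_eqVlt => /predU1P[->|xy].
  by rewrite !subrr mulr0.
have dP z : J F z -> is_derive z 1 (fun z => F z `^ (1 - s))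
    ((1 - s) * F z `^ (- s) * f z).
  move=> Jz; have /andP[Fz0 _] := Jz.
  have := is_derive_powR (1 - s) Fz0; rewrite addrAC subrr sub0r => dz.
  exact: (is_derive1_comp dz (dF z Jz)).
have [w [Jw xw wy /= E]] := J_MVT Fnd dP Jx Jy xy.
have /andP[Fx0 Fx1] := Jx; have /andP[Fy0 Fy1] := Jy.
have /andP[Fw0 Fw1] := Jw; have /andP[Fc0 Fc1] := Jc.
have FwN : F w `^ (- s) <= N.
  have [s0|s0] := leP 0 s.
    rewrite /N ler_wpDl// !powRN lef_pV2 ?posrE ?powR_gt0//.
    apply: ge0_ler_powR => //; rewrite ?nnegrE; [exact: ltW|exact: ltW|].
    by apply/Fnd/(le_trans cx)/ltW.
  rewrite /N ler_wpDr ?powR_ge0// powR_le1 ?Fw0 ?ltW// oppr_gt0//.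
have : f y - f x <= rev_hazard s F f x * (F y `^ (1 - s) - F x `^ (1 - s)).
  rewrite mulrBr -(@rev_hazardK _ s F)// lerD2r.
  rewrite {1}(@rev_hazardK _ s F)//.
  by rewrite ler_wpM2r ?powR_ge0// rF// ltW.
move=> /le_trans; apply; rewrite E mulrA -[leRHS]mulrA.
have yx0 : 0 <= y - x by rewrite subr_ge0 ltW.
rewrite mulrA ler_wpM2r// ler_pM// ?rF//.
- exact/rev_hazard_ge0/f0.
- apply: mulr_ge0; last exact: f0.
  by apply: mulr_ge0 => //; exact: powR_ge0.
- apply: ler_pM; [|exact: f0|exact: ler_wpM2l|exact: fM].
  by apply: mulr_ge0 => //; exact: powR_ge0.
Qed.

(** The product rule for [f * F^(s-1)] yields a nonpositive derivative, which is then divided by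
    [F x^(s-1)]. *)
Lemma rev_hazard_nonincreasing_derive (R : realType) (s a : R) (F f : R -> R)
    (x : R) : continuous F ->
  (forall x, J F x -> is_derive x 1 F (f x)) ->
  rev_hazard_nonincreasing s F f -> J F x ->
  is_derive x 1 f a -> a <= (1 - s) * (f x ^+ 2 / F x).
Proof.
move=> cF dF rF Jx df; have /andP[Fx0 _] := Jx.
have dP : is_derive x 1 (fun z => F z `^ (s - 1))
    ((s - 1) * F x `^ (s - 1 - 1) * f x).
  exact: (is_derive1_comp (is_derive_powR (s - 1) Fx0) (dF x Jx)).
have dr := is_deriveN (is_deriveM df dP).
have Jnear := open_nbhs_nbhs (conj (open_J cF) Jx).
have /is_derive_nondecreasing_ge0/(_ dr) : \forall y \near x, x < y ->
    - (f * (fun z => F z `^ (s - 1))) x <= - (f * (fun z => F z `^ (s - 1))) y.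
  apply: filterS Jnear => y Jy /ltW xy.
  by have := rF x y Jx Jy xy; rewrite !rev_hazardE lerN2.
rewrite /GRing.scale/= oppr_ge0.
rewrite powRB; last by rewrite (gt_eqF Fx0) implybT.
rewrite powRr1 ?(ltW Fx0)//.
have P0 : 0 < F x `^ (s - 1) by exact: powR_gt0.
set P := F x `^ _ in P0 * => h; rewrite -(@ler_pM2l _ P)//.
rewrite -subr_ge0 -oppr_le0; apply: le_trans h; rewrite le_eqVlt; apply/orP;
  left.
by apply/eqP; field; rewrite gt_eqF.
Qed.

(** * Bounds on the second derivative *)

(** For fixed [e], let [c] be the supremum of the [t] with [g t - g a <= e * (t - a)]. The
    hypothesis at [c] puts [c] itself in this set, and then a point beyond [c] as well unless
    [c = b]. Multiplying by [y - x] states the slope bound for both sides at once. *)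
Lemma near_upper_slope_nonincreasing (R : realType) (g : R -> R) (a b : R) :
  a <= b ->
  (forall x e, a <= x <= b -> 0 < e ->
    \forall y \near x, (g y - g x) * (y - x) <= e * (y - x) ^+ 2) ->
  g b <= g a.
Proof.
move=> ab gab; suff h e : 0 < e -> g b - g a <= e * (b - a).
  apply/ler_addgt0Pr => e e0.
  have ba0 : 0 < b - a + 1 by rewrite ltr_wpDl ?subr_ge0.
  rewrite -lerBlDl; apply: le_trans (h (e / (b - a + 1)) _) _.
    by rewrite divr_gt0.
  rewrite mulrAC ler_pdivrMr//; nra.
move=> e0; pose S := [set t | a <= t <= b /\ g t - g a <= e * (t - a)].
have Sa : S a by split; rewrite ?lexx ?ab// !subrr mulr0.
have ubS : has_ubound S by exists b => t [/andP[]].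
have supS : has_sup S by split; [exists a|].
pose c := sup S.
have ac : a <= c by exact: ub_le_sup.
have cb : c <= b by apply: ge_sup; [exists a|move=> t [/andP[]]].
have acb : a <= c <= b by rewrite ac.
have /nbhs_ballP[d /= d0 cd] := gab c e acb e0.
have slope y : `|c - y| < d -> (g y - g c) * (y - c) <= e * (y - c) ^+ 2.
  by move=> cyd; exact: cd.
have [t [/andP[ta tb] gt] ct] := sup_adherent d0 supS.
rewrite -/c in ct.
have tc : t <= c by apply: ub_le_sup => //; split; rewrite ?ta.
have Sc : g c - g a <= e * (c - a).
  move: tc; rewrite le_eqVlt => /predU1P[<-//|tc].
  have := slope t; rewrite gtr0_norm ?subr_gt0// => /(_ ltac:(lra)).
  have := tc; rewrite -subr_gt0 => tc0 h.
  have : g c - g t <= e * (c - t) by rewrite -(ler_pM2r tc0); lra.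
  by lra.
move: cb; rewrite le_eqVlt => /predU1P[<-//|cb].
(* A point beyond [c], still in [[a, b]] and in the ball where the slope bound holds. *)
pose y := Num.min b (c + d / 2).
have d20 : 0 < d / 2 by rewrite divr_gt0.
have [cy yb yd] : [/\ c < y, y <= b & y <= c + d / 2].
  by rewrite /y lt_min !ge_min !lexx orbT cb ltrDl; split.
have := slope y; rewrite ltr0_norm ?subr_lt0// => /(_ ltac:(lra)).
have cy0 : 0 < y - c by rewrite subr_gt0.
rewrite expr2 mulrA ler_pM2r// => gy.
suff /(ub_le_sup ubS) : S y by rewrite -/c leNgt cy.
by split; [apply/andP; split; lra|lra].
Qed.

(** Integration turns a bound on [f'] off a null set into a bound on difference quotients at every
    point. *)
Lemma L1_derivative_near_le (R : realType) (D : set R) (f f' phi : R -> R)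
    (C x : R) :
  L1_derivative D f f' ->
  {ae @lebesgue_measure R, forall t : R, D t -> f' t <= phi t} ->
  (\forall t \near x, D t /\ phi t <= C) ->
  \forall y \near x, (f y - f x) * (y - x) <= C * (y - x) ^+ 2.
Proof.
move=> Lf f'phi /nbhs_ballP[d /= d0 xd].
have aef := ae_filter_ringOfSetsType (@lebesgue_measure R).
have key u v : `|x - u| < d -> `|x - v| < d -> u <= v ->
  f v - f u <= C * (v - u).
  move=> xu xv uv; have [Du _] := xd u xu; have [Dv _] := xd v xv.
  have [if' ->] := Lf u v Du Dv uv; apply: Rintegral_itv_ae_le => //.
  apply: (@filterS _ _ aef _ _ _ f'phi) => t h /andP[ut tv].
  have [|Dt phit] := xd t; last exact: le_trans (h Dt) phit.
  move: xu xv; rewrite /ball/= !ltr_norml => /andP[? ?] /andP[? ?].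
  by apply/andP; split; lra.
apply/nbhs_ballP; exists d => //= y; rewrite /ball/= => xy.
have xx : `|x - x| < d by rewrite subrr normr0.
rewrite expr2 mulrA; have [xley|/ltW yx] := leP x y.
  by rewrite ler_wpM2r ?subr_ge0//; exact: key.
have := key y x xy xx yx; have : 0 <= x - y by rewrite subr_ge0.
by move=> h /(ler_wpM2r h); lra.
Qed.

Lemma L1_derivative_near_ge (R : realType) (D : set R) (f f' phi : R -> R)
    (C x : R) :
  L1_derivative D f f' ->
  {ae @lebesgue_measure R, forall t : R, D t -> phi t <= f' t} ->
  (\forall t \near x, D t /\ C <= phi t) ->
  \forall y \near x, C * (y - x) ^+ 2 <= (f y - f x) * (y - x).
Proof.
move=> Lf f'phi /nbhs_ballP[d /= d0 xd].
have aef := ae_filter_ringOfSetsType (@lebesgue_measure R).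
have key u v : `|x - u| < d -> `|x - v| < d -> u <= v ->
  C * (v - u) <= f v - f u.
  move=> xu xv uv; have [Du _] := xd u xu; have [Dv _] := xd v xv.
  have [if' ->] := Lf u v Du Dv uv; apply: Rintegral_itv_ae_ge => //.
  apply: (@filterS _ _ aef _ _ _ f'phi) => t h /andP[ut tv].
  have [|Dt phit] := xd t; last exact: le_trans phit (h Dt).
  move: xu xv; rewrite /ball/= !ltr_norml => /andP[? ?] /andP[? ?].
  by apply/andP; split; lra.
apply/nbhs_ballP; exists d => //= y; rewrite /ball/= => xy.
have xx : `|x - x| < d by rewrite subrr normr0.
rewrite expr2 mulrA; have [xley|/ltW yx] := leP x y.
  by rewrite ler_wpM2r ?subr_ge0//; exact: key.
have := key y x xy xx yx; have : 0 <= x - y by rewrite subr_ge0.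
by move=> h /(ler_wpM2r h); lra.
Qed.

(** A product rule for upper slopes: [F^(s-1)] is differentiable at [x], while for [f] only the
    upper slope bound is used. *)
Lemma near_upper_slope_rev_hazard (R : realType) (s : R) (F f : R -> R)
    (x : R) :
  continuous F -> (forall x, J F x -> is_derive x 1 F (f x)) ->
  (forall x e, J F x -> 0 < e -> \forall y \near x, (f y - f x) * (y - x) <=
    ((1 - s) * (f x ^+ 2 / F x) + e) * (y - x) ^+ 2) ->
  forall e, J F x -> 0 < e -> \forall y \near x,
    (rev_hazard s F f y - rev_hazard s F f x) * (y - x) <= e * (y - x) ^+ 2.
Proof.
move=> cF dF fD e Jx e0; have /andP[Fx0 _] := Jx.
pose P z := F z `^ (s - 1); have Px0 : 0 < P x by exact: powR_gt0.
have dP : is_derive x 1 P ((s - 1) * F x `^ (s - 1 - 1) * f x).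
  exact: (is_derive1_comp (is_derive_powR (s - 1) Fx0) (dF x Jx)).
have cP := is_derive_continuous dP.
have [g [gE cg gx]] := (is_derive1_caratheodory _ _ _).1 dP.
(* Chosen so that the main terms of [B x] cancel and [B x = e / 2], leaving room for continuity. *)
pose e' := e / 2 / P x.
have e'0 : 0 < e' by rewrite !divr_gt0.
pose C := (1 - s) * (f x ^+ 2 / F x) + e'.
pose B y := C * P y + f x * g y.
have cB : {for x, continuous B}.
  by apply: continuousD; apply: continuousM => //; exact: cvg_cst.
have Bx : B x < e.
  suff -> : B x = e / 2 by lra.
  rewrite /B /C gx powRB; last by rewrite (gt_eqF Fx0) implybT.
  rewrite powRr1 ?(ltW Fx0)// -/(P x) /e'; field.
  by rewrite !gt_eqF.
have nB : \forall y \near x, B y < e by exact: cB _ (lt_nbhsl Bx).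
have := fD x e' Jx e'0; apply: filterS2 nB => y By fy.
rewrite !rev_hazardE -/(P y) -/(P x).
have -> : (f y * P y - f x * P x) * (y - x) =
    P y * ((f y - f x) * (y - x)) + f x * (g y * (y - x)) * (y - x).
  by rewrite -gE; ring.
apply: (@le_trans _ _ (B y * (y - x) ^+ 2)); last first.
  by rewrite ler_wpM2r ?sqr_ge0// ltW.
have /(ler_wpM2l (powR_ge0 (F y) (s - 1))) := fy.
rewrite -/(P y) -/C /B; lra.
Qed.

Lemma is_derive_compN (R : realType) (f : R -> R) (x a : R) :
  is_derive x 1 f a -> is_derive (- x) 1 (f \o -%R) (- a).
Proof.
move=> /is_derive1_caratheodory[g [gE cg gx]].
apply/is_derive1_caratheodory; exists (fun z => - g (- z)); split => //=.
- by move=> z; rewrite opprK gE; ring.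
- apply: continuousN; apply: continuous_comp; first exact: opp_continuous.
  by rewrite opprK.
- by rewrite opprK gx.
Qed.

(** On [[c, d]] the denominators stay away from 0, as [F >= F c] and [1 - F >= 1 - F d], so the
    bounds on [f'] are uniform. *)
Lemma second_derivative_bounds_lipschitz (R : realType) (s M : R)
    (F f f' : R -> R) (c d : R) :
  s <= 1 -> {homo F : x y / x <= y} -> (forall x, J F x -> `|f x| <= M) ->
  L1_derivative (J F) f f' ->
  {ae @lebesgue_measure R, forall x : R, J F x ->
    - (1 - s) * (f x ^+ 2 / (1 - F x)) <= f' x <= (1 - s) * (f x ^+ 2 / F x)} ->
  J F c -> J F d -> exists K, forall x y, c <= x -> x <= y -> y <= d ->
    `|f y - f x| <= K * (y - x).
Proof.
move=> s1 Fnd fM Lf f'B Jc Jd.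
have aef := ae_filter_ringOfSetsType (@lebesgue_measure R).
have s10 : 0 <= 1 - s by rewrite subr_ge0.
have /andP[Fc0 _] := Jc; have /andP[_ Fd1] := Jd; rewrite -subr_gt0 in Fd1.
have f2 t : J F t -> f t ^+ 2 <= M ^+ 2.
  move=> /fM; rewrite ler_norml => /andP[? ?].
  by rewrite -subr_ge0 subr_sqr mulr_ge0//; lra.
pose K1 := (1 - s) * (M ^+ 2 / F c); pose K2 := (1 - s) * (M ^+ 2 / (1 - F d)).
have K10 : 0 <= K1 by rewrite mulr_ge0// divr_ge0 ?sqr_ge0// ltW.
have K20 : 0 <= K2 by rewrite mulr_ge0// divr_ge0 ?sqr_ge0// ltW.
have Jcd t : c <= t <= d -> J F t by exact: J_itv.
exists (K1 + K2) => x y cx xy yd.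
have Jx : J F x by apply: Jcd; lra.
have Jy : J F y by apply: Jcd; lra.
have [if' ->] := Lf x y Jx Jy xy; rewrite ler_norml -mulNr; apply/andP; split.
  apply: Rintegral_itv_ae_ge => //.
  apply: (@filterS _ _ aef _ _ _ f'B) => t + /andP[xt ty].
  have Jt : J F t by apply: Jcd; lra.
  move=> /(_ Jt)/andP[+ _]; apply: le_trans.
  rewrite mulNr lerN2; apply: (@le_trans _ _ K2); last by rewrite lerDr.
  rewrite /K2 ler_wpM2l// ler_pM ?sqr_ge0 ?invr_ge0 ?subr_ge0 ?f2//.
    by case/andP: Jt => _ /ltW.
  have : F t <= F d by apply: Fnd; lra.
  by move=> Ftd; rewrite lef_pV2 ?posrE//; lra.
apply: Rintegral_itv_ae_le => //.
apply: (@filterS _ _ aef _ _ _ f'B) => t + /andP[xt ty].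
have Jt : J F t by apply: Jcd; lra.
move=> /(_ Jt)/andP[_ +] => /le_trans; apply.
apply: (@le_trans _ _ K1); last by rewrite lerDl.
have Fct : F c <= F t by apply: Fnd; lra.
rewrite /K1 ler_wpM2l// ler_pM ?sqr_ge0 ?invr_ge0 ?f2//; first lra.
by rewrite lef_pV2 ?posrE//; lra.
Qed.

(** As [f] is continuous, so are the bounds on [f'], and up to [e] they may be frozen at [x]. The
    upper one handles [F]; the lower one, read through [x |-> - x], handles [reflect F]. *)
Lemma second_derivative_bounds_nonincreasing (R : realType) (s M : R)
    (F f : R -> R) :
  s <= 1 -> cdf F -> continuous F ->
  (forall x, J F x -> is_derive x 1 F (f x)) ->
  (forall x, J F x -> `|f x| <= M) -> second_derivative_bounds s F f ->
  rev_hazard_nonincreasing s F f /\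
  rev_hazard_nonincreasing s (reflect F) (f \o -%R).
Proof.
move=> s1 cdfF cF dF fM [f' [Lf f'ae]]; have [Fnd _ _ _] := cdfF.
have aef := ae_filter_ringOfSetsType (@lebesgue_measure R).
have f'B : {ae @lebesgue_measure R, forall x : R, J F x ->
    - (1 - s) * (f x ^+ 2 / (1 - F x)) <= f' x <= (1 - s) * (f x ^+ 2 / F x)}.
  by apply: (@filterS _ _ aef _ _ _ f'ae) => x h /h[].
have cf : forall x, J F x -> {for x, continuous f}.
  apply: (locally_lipschitz_continuous (open_J cF)) => c d Jc Jd _.
  exact: (second_derivative_bounds_lipschitz s1 Fnd fM Lf f'B Jc Jd).
have Jnear x : J F x -> \forall y \near x, J F y.
  by move=> Jx; exact: open_nbhs_nbhs (conj (open_J cF) Jx).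
have cf2 x : J F x -> {for x, continuous (fun t => f t ^+ 2)}.
  by move=> Jx; apply: continuousM; exact: cf.
have upper x e : J F x -> 0 < e -> \forall y \near x, (f y - f x) * (y - x) <=
    ((1 - s) * (f x ^+ 2 / F x) + e) * (y - x) ^+ 2.
  move=> Jx e0; apply: (@L1_derivative_near_le _ _ _ _
    (fun t => (1 - s) * (f t ^+ 2 / F t)) _ _ Lf).
    by apply: (@filterS _ _ aef _ _ _ f'B) => t h /h/andP[_ +]; exact.
  have cphi : {for x, continuous (fun t => (1 - s) * (f t ^+ 2 / F t))}.
    apply: continuousM; first exact: cvg_cst.
    apply: continuousM; first exact: cf2.
    by apply: continuousV; [case/andP: Jx => /lt0r_neq0|exact: cF].
  have : \forall t \near x, (1 - s) * (f t ^+ 2 / F t) <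
      (1 - s) * (f x ^+ 2 / F x) + e.
    by apply: cphi _ (lt_nbhsl _); rewrite ltrDl.
  by apply: filterS2 (Jnear x Jx) => t Jt /ltW.
have lower x e : J F x -> 0 < e -> \forall y \near x,
    (- (1 - s) * (f x ^+ 2 / (1 - F x)) - e) * (y - x) ^+ 2 <=
    (f y - f x) * (y - x).
  move=> Jx e0; apply: (@L1_derivative_near_ge _ _ _ _
    (fun t => - (1 - s) * (f t ^+ 2 / (1 - F t))) _ _ Lf).
    by apply: (@filterS _ _ aef _ _ _ f'B) => t h /h/andP[+ _]; exact.
  have cphi : {for x, continuous (fun t => - (1 - s) * (f t ^+ 2 / (1 - F t)))}.
    apply: continuousM; first exact: cvg_cst.
    apply: continuousM; first exact: cf2.
    apply: continuousV; first by case/andP: Jx => _;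
      rewrite -subr_gt0 => /lt0r_neq0.
    by apply: continuousB; [exact: cvg_cst|exact: cF].
  have : \forall t \near x, - (1 - s) * (f x ^+ 2 / (1 - F x)) - e <
      - (1 - s) * (f t ^+ 2 / (1 - F t)).
    by apply: cphi _ (lt_nbhsr _); rewrite gtrDl oppr_lt0.
  by apply: filterS2 (Jnear x Jx) => t Jt /ltW.
split.
  move=> x y Jx Jy xy; apply: near_upper_slope_nonincreasing xy _ => z e xzy e0.
  by apply: near_upper_slope_rev_hazard upper e _ e0 => //; exact: J_itv xzy.
have cG : continuous (reflect F).
  by move=> x; apply/continuous_reflect; exact: cF.
have dG x : J (reflect F) x -> is_derive x 1 (reflect F) ((f \o -%R) x).
  by move=> /J_reflect Jx; apply/is_derive_reflect; exact: dF.
move=> x y Jx Jy xy; apply: near_upper_slope_nonincreasing xy _ => z e xzy e0.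
apply: near_upper_slope_rev_hazard e _ e0 => //; last first.
  by apply: J_itv xzy => //; exact: nondecreasing_reflect.
move=> w d /J_reflect Jw d0; have h := lower _ _ Jw d0.
have : \forall v \near w, (- (1 - s) * (f (- w) ^+ 2 / (1 - F (- w))) - d) *
    (- v - - w) ^+ 2 <= (f (- v) - f (- w)) * (- v - - w).
  have cN : {for w, continuous (-%R : R -> R)} by exact: opp_continuous.
  exact: cN _ h.
by apply: filterS => v; rewrite /reflect /=; lra.
Qed.

Lemma rev_hazard_nonincreasing_second_derivative (R : realType) (s : R)
    (F f : R -> R) :
  s <= 1 -> cdf F -> continuous F ->
  (forall x, J F x -> is_derive x 1 F (f x)) ->
  rev_hazard_nonincreasing s F f ->
  rev_hazard_nonincreasing s (reflect F) (f \o -%R) ->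
  second_derivative_bounds s F f.
Proof.
move=> s1 cdfF cF dF rF rG; have [Fnd _ _ _] := cdfF.
have f0 := derive_ge0 Fnd dF.
have Gnd := nondecreasing_reflect Fnd.
have cG : continuous (reflect F).
  by move=> x; apply/continuous_reflect; exact: cF.
have dG x : J (reflect F) x -> is_derive x 1 (reflect F) ((f \o -%R) x).
  by move=> /J_reflect Jx; apply/is_derive_reflect; exact: dF.
have JN z : J F z -> J (reflect F) (- z).
  by move=> Jz; apply/J_reflect; rewrite opprK.
have [M fM] := rev_hazard_nonincreasing_bounded s1 f0 rF rG.
have gM x : J (reflect F) x -> (f \o -%R) x <= M by move=> /J_reflect/fM.
have [||f' [Lf df]] := @locally_lipschitz_L1_derivative _ (J F) f (open_J cF).
- by move=> x y Jx Jy z xzy; exact: J_itv xzy.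
- move=> c d Jc Jd _.
  (* The estimate for [F] starts from the left end [c], that for [reflect F] from the right end [d];
     together they bound [f y - f x] on both sides. *)
  have [K K0 fK] := rev_hazard_nonincreasing_lipschitz s1 Fnd dF fM rF Jc.
  have [L L0 gL] :=
    rev_hazard_nonincreasing_lipschitz s1 Gnd dG gM rG (JN _ Jd).
  exists (K + L) => x y cx xy yd.
  have Jx : J F x by apply: (J_itv Fnd Jc Jd); lra.
  have Jy : J F y by apply: (J_itv Fnd Jc Jd); lra.
  have := fK x y Jx Jy cx xy.
  have := gL (- y) (- x) (JN _ Jy) (JN _ Jx); rewrite !lerN2 => /(_ yd xy).
  have yx0 : 0 <= y - x by rewrite subr_ge0.
  have := mulr_ge0 K0 yx0; have := mulr_ge0 L0 yx0.
  by rewrite /= !opprK ler_norml => ? ? ? ?; apply/andP; split; lra.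
exists f'; split => //.
have aef := ae_filter_ringOfSetsType (@lebesgue_measure R).
apply: (@filterS _ _ aef _ _ _ df) => x dfx Jx; have {}dfx := dfx Jx.
split=> //; apply/andP; split; last first.
  exact: rev_hazard_nonincreasing_derive dfx.
(* The reflected density has derivative [- f' x] at [- x], so its upper bound is the lower bound
   sought. *)
have dgx := is_derive_compN dfx.
have := rev_hazard_nonincreasing_derive cG dG rG (JN _ Jx) dgx.
by rewrite /reflect /= opprK; lra.
Qed.

(** * Distribution functions and the equivalence *)

Lemma cumulativeBounded_cdf (R : realType)
    (F : cumulativeBounded (0 : R) (1 : R)) : cdf F.
Proof.
have Fnd : {homo F : x y / x <= y} := cumulative_is_nondecreasing F.
have F0 e : 0 < e -> exists x, F x < e.
  move=> e0; have [M [_ MF]] := cumulativeNy F _ (lt_nbhsl e0).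
  by exists (M - 1); apply: MF; rewrite gtrDl oppr_lt0.
have F1 e : 0 < e -> exists x, 1 - e < F x.
  move=> e0; have e1 : 1 - e < (1 : R) by rewrite gtrDl oppr_lt0.
  have [M [_ MF]] := cumulativey F _ (lt_nbhsr e1).
  by exists (M + 1); apply: MF; rewrite ltrDl.
split => // x; apply/andP; split; rewrite leNgt; apply/negP => Fx.
  have [M [_ MF]] := cumulativeNy F _ (lt_nbhsr Fx).
  have /MF/= : Num.min (M - 1) x < M by rewrite gt_min gtrDl oppr_lt0 ltr01.
  by rewrite ltNge Fnd// ge_min lexx orbT.
have [M [_ MF]] := cumulativey F _ (lt_nbhsl Fx).
have /MF/= : M < Num.max (M + 1) x by rewrite lt_max ltrDl ltr01.
by rewrite ltNge Fnd// le_max lexx orbT.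
Qed.

Lemma cumulative_right_lt (R : realType) (F : cumulative R R) (x v : R) :
  F x < v -> exists2 y, x < y & F y < v.
Proof.
move=> Fxv; have e0 : 0 < (v - F x) / 2 by rewrite divr_gt0// subr_gt0.
have [d Fd] := nondecreasing_right_continuousP x F e0.
exists (x + d%:num); first by rewrite ltrDl.
by apply: le_lt_trans Fd _; lra.
Qed.

(** If [J F] were empty, [F] would take only the values 0 and 1 and, by right-continuity, jump to 1
    at the infimum of the points where it is 1: a point mass. Right-continuity at [m] also provides
    [n]. *)
Lemma nondegenerate_J (R : realType) (F : cumulativeBounded (0 : R) (1 : R)) :
  ~ degenerate F -> exists m n, [/\ J F m, J F n & m < n].
Proof.
move=> Fnondeg; have [Fnd F01 F0 F1] := cumulativeBounded_cdf F.
have [m Jm] : exists m, J F m.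
  apply: contrapT => noJ; apply: Fnondeg.
  have FP x : F x = 0 \/ F x = 1.
    have /andP[] := F01 x; rewrite le_eqVlt => /predU1P[<-|x0]; first by left.
    rewrite le_eqVlt => /predU1P[->|x1]; first by right.
    by exfalso; apply: noJ; exists x; rewrite /J/= x0.
  pose S := [set x | F x = 1].
  have [x0 Fx0] := F0 1 ltr01.
  have [x1 Fx1] := F1 1 ltr01; rewrite subrr in Fx1.
  have S1 : S x1 by case: (FP x1) => // E; rewrite E ltxx in Fx1.
  have lbS : lbound S x0.
    move=> y Sy; rewrite leNgt; apply/negP => /ltW/Fnd; rewrite Sy; lra.
  have infS : has_inf S by split; [exists x1|exists x0].
  exists (inf S) => x; rewrite diracE.
  have [Sx|xS] := leP (inf S) x.
    rewrite mem_set /=; last by rewrite in_itv.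
    congr (_%:E); case: (FP x) => // Fx; exfalso.
    have Fxlt1 : F x < 1 by rewrite Fx.
    have [y xy Fy] := cumulative_right_lt Fxlt1.
    have d0 : 0 < y - inf S by rewrite subr_gt0 (le_lt_trans Sx).
    have [z Sz] := inf_adherent d0 infS.
    by rewrite addrC subrK => /ltW/Fnd; rewrite Sz leNgt Fy.
  rewrite memNset /=; last by rewrite in_itv/= => /(lt_le_trans xS);
    rewrite ltxx.
  congr (_%:E); case: (FP x) => // Fx; exfalso.
  by move: xS; rewrite ltNge => /negP; apply; apply: ge_inf => //; exists x0.
have /andP[Fm0 Fm1] := Jm; have [n mn Fn] := cumulative_right_lt Fm1.
by exists m, n; split => //; rewrite /J/= Fn (lt_le_trans Fm0)// Fnd// ltW.
Qed.

(** The second inequality of (ii) is the first one for [1 - F], whose derivative is [- f]. *)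
Lemma bi_concave_boundsE (R : realType) (s : R) (F f : R -> R) :
  bi_concave_bounds s F f <->
  tangent_bound s F f /\ tangent_bound s (reflect F) (f \o -%R).
Proof.
have half x y : J F x -> J F y ->
    half_bound s (F x) (F y) (f x * (y - x)) /\
    half_bound s (1 - F x) (1 - F y) (- (f x * (y - x))) <->
    if s == 0 then
      F y <= F x * expR (f x / F x * (y - x)) /\
      F y >= 1 - (1 - F x) * expR (- (f x / (1 - F x) * (y - x)))
    else
      ((F y)%:E <=
        (F x)%:E * epow (pospart (1 + s * (f x / F x) * (y - x))) s^-1)%E /\
      ((F y)%:E >=
        1 - (1 - F x)%:E *
              epow (pospart (1 - s * (f x / (1 - F x)) * (y - x))) s^-1)%E.
  move=> Jx Jy; rewrite /half_bound.
  have -> : f x * (y - x) / F x = f x / F x * (y - x) by rewrite mulrAC.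
  have -> : - (f x * (y - x)) / (1 - F x) = - (f x / (1 - F x) * (y - x)).
    by rewrite mulNr mulrAC.
  case: ifP => _.
    by split=> -[h1 h2]; split=> //; lra.
  rewrite -!(mulrA s) mulrN.
  set E := epow _ _ ; set E' := epow (pospart (1 - _)) _.
  (* [X] may be [+oo], so the terms are exchanged by cases in the extended reals. *)
  have dual (X : \bar R) : (1 - X <= (F y)%:E)%E <-> ((1 - F y)%:E <= X)%E.
    by case: X => [r||] /=; rewrite ?leNye ?leey// -?EFinB ?lee_fin; lra.
  by split=> -[h1 h2]; split=> //; apply/dual.
split=> [b|[b1 b2] x y Jx Jy].
  split=> x y.
    move=> Jx Jy; have /andP[Fx _] := Jx; have /andP[Fy _] := Jy.
    have [h _] := (half x y Jx Jy).2 (b x y Jx Jy).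
    by rewrite mulrAC; exact/(half_boundE _ _ Fx Fy).
  move=> /J_reflect Jx /J_reflect Jy.
  have /andP[_ Fx] := Jx; have /andP[_ Fy] := Jy.
  move: Fx Fy; rewrite -(subr_gt0 _ 1) -(subr_gt0 (F (- y)) 1) => Fx Fy.
  have [_ h] := (half _ _ Jx Jy).2 (b _ _ Jx Jy).
  rewrite /reflect mulrAC; apply/half_boundE => //=.
  by have <- : - (f (- x) * (- y - - x)) = f (- x) * (y - x) by ring.
apply/half => //.
have /andP[Fx0 Fx1] := Jx; have /andP[Fy0 Fy1] := Jy.
move: Fx1 Fy1; rewrite -(subr_gt0 _ 1) -(subr_gt0 (F y) 1) => Fx1 Fy1.
split; apply/half_boundE => //.
  by rewrite mulrAC; exact: b1.
have := b2 (- x) (- y); rewrite !J_reflect /reflect !opprK => /(_ Jx Jy) /=.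
by rewrite opprK; lra.
Qed.

Theorem theorem3 (R : realType) (s : R) (F : cumulativeBounded (0 : R) (1 : R))
  (s_le1 : s <= 1) (F_nondeg : ~ degenerate F) :
  [<->
    bi_concave s F;
    exists f : R -> R,
      continuous_with_derivative F f /\ bi_concave_bounds s F f;
    exists f : R -> R,
      [/\ continuous_with_derivative F f,
          {in J F &, {homo hazard s F f : x y / x <= y}} &
          {in J F &, {homo rev_hazard s F f : x y / x <= y >-> y <= x}}];
    exists f : R -> R,
      [/\ continuous_with_derivative F f,
          [bounded f x | x in J F],
          (forall x, J F x -> 0 < f x) &
          second_derivative_bounds s F f]].
Proof.
have cdfF := cumulativeBounded_cdf F; have [Fnd F01 _ _] := cdfF.
have JN z : J F z -> J (reflect F) (- z).
  by move=> Jz; apply/J_reflect; rewrite opprK.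
have hazardP (f : R -> R) :
    {in J F &, {homo hazard s F f : x y / x <= y}} <->
    rev_hazard_nonincreasing s (reflect F) (f \o -%R).
  split=> [h x y /J_reflect Jx /J_reflect Jy xy
    |h x y /set_mem Jx /set_mem Jy xy].
    have := h _ _ (mem_set Jy) (mem_set Jx); rewrite lerN2 => /(_ xy).
    by rewrite !hazardE !opprK.
  by rewrite !hazardE; apply: h; rewrite ?lerN2//; exact: JN.
have rev_hazardP (f : R -> R) :
    {in J F &, {homo rev_hazard s F f : x y / x <= y >-> y <= x}} <->
    rev_hazard_nonincreasing s F f.
  split=> h x y Jx Jy; first exact: h (mem_set Jx) (mem_set Jy).
  by apply: h; exact: set_mem.
have reflect_derive (f : R -> R) : (forall x, J F x -> is_derive x 1 F (f x)) ->
    forall x, J (reflect F) x -> is_derive x 1 (reflect F) ((f \o -%R) x).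
  by move=> dF x /J_reflect Jx; apply/is_derive_reflect; exact: dF.
tfae.
- move=> /bi_concaveE[FC GC];
  have [m [n [Jm Jn mn]]] := nondegenerate_J F_nondeg.
  have [cF [f [dF FT GT]]] := transform_concave_tangent s_le1 cdfF Jm Jn mn
    (half_transform_concave Fnd FC)
    (half_transform_concave (nondecreasing_reflect Fnd) GC).
  by exists f; split => //; apply/bi_concave_boundsE.
- move=> [f [[cF dF] /bi_concave_boundsE[FT GT]]]; exists f; split => //.
    by apply/hazardP; exact: tangent_bound_nonincreasing.
  by apply/rev_hazardP; exact: tangent_bound_nonincreasing.
- move=> [f [[cF dF] /hazardP rG /rev_hazardP rF]]; exists f.
  have f_gt0 := rev_hazard_nonincreasing_pos cdfF cF dF rF rG.
  have [M fM] := rev_hazard_nonincreasing_bounded s_le1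
    (fun x Jx => ltW (f_gt0 x Jx)) rF rG.
  split => //; last exact: rev_hazard_nonincreasing_second_derivative.
  exists M; split; first exact: num_real.
  move=> M' MM' x Jx /=; rewrite gtr0_norm ?f_gt0//.
  by apply: le_trans (fM x Jx) _; exact: ltW.
- move=> [f [[cF dF] [M [_ fM]] _ f2]].
  (* Boundedness provides the estimate only for numbers strictly above [M]. *)
  have fM1 x : J F x -> `|f x| <= M + 1 by apply: fM; rewrite ltrDl.
  have [rF rG] :=
    second_derivative_bounds_nonincreasing s_le1 cdfF cF dF fM1 f2.
  have cG : continuous (reflect F).
    by move=> x; apply/continuous_reflect; exact: cF.
  have half (H g : R -> R) : cdf H -> continuous H ->
      (forall x, J H x -> is_derive x 1 H (g x)) ->
      rev_hazard_nonincreasing s H g -> half_bi_concave s H.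
    move=> cdfH cH dH rH; have [Hnd _ _ _] := cdfH.
    apply: transform_concave_half => //.
    apply: (tangent_transform_concave cdfH cH (derive_ge0 Hnd dH)).
    exact: nonincreasing_tangent.
  apply/bi_concaveE; split; first exact: half rF.
  exact: half (cdf_reflect cdfF) cG (reflect_derive f dF) rG.
Qed.
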